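(* Let $d,m,N$ be positive integers, $0<\Lambda_1<\dots<\Lambda_N$, $A_1,\dots,A_N\in\mathbb{R}^{d\times d}$, $B\in\mathbb{R}^{d\times m}$, $g\in L^\infty([0,\Lambda_N],\mathbb{R}^{d\times d})$, $q\in[1,+\infty)$, and consider $$x(t)=\sum_{j=1}^N A_j x(t-\Lambda_j)+\int_0^{\Lambda_N} g(s)x(t-s)\,ds+Bu(t),\qquad t\ge 0. \quad (\Sigma)$$ Then $(\Sigma)$ is $L^q$ approximately controllable from the origin if and only if it is $L^q$ approximately controllable from the origin in time $T$ for every $T>2d\Lambda_N$.
   Context: For $T\ge 0$, $\phi\in L^q([-\Lambda_N,0],\mathbb{R}^d)$ and $u\in L^q([0,T],\mathbb{R}^m)$ there is a unique $x\in L^q([-\Lambda_N,T],\mathbb{R}^d)$ equal to $\phi$ on $[-\Lambda_N,0]$ and satisfying $(\Sigma)$ a.e. on $[0,T]$; $x_t(\theta):=x(t+\theta)$ for $\theta\in[-\Lambda_N,0]$, and $\|\cdot\|_{[-\Lambda_N,0],q}$ is the $L^q$ norm on $[-\Lambda_N,0]$. $(\Sigma)$ is $L^q$ approximately controllable from the origin if, with $\phi\equiv0$, for every $\psi\in L^q([-\Lambda_N,0],\mathbb{R}^d)$ and $\epsilon>0$ there exist $T_{\epsilon,\psi}>0$ and $u\in L^q([0,T_{\epsilon,\psi}],\mathbb{R}^m)$ with $\|x_{T_{\epsilon,\psi}}-\psi\|_{[-\Lambda_N,0],q}<\epsilon$. It is $L^q$ approximately controllable from the origin in time $T>0$ if,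 with $\phi\equiv 0$, for every $\psi$ and $\epsilon>0$ there exists $u\in L^q([0,T],\mathbb{R}^m)$ with $\|x_T-\psi\|_{[-\Lambda_N,0],q}<\epsilon$. *)

(* Defs.v *)
From HB Require Import structures.
From mathcomp Require Import all_boot all_order all_algebra.
From mathcomp Require Import all_classical all_reals all_analysis.
Set Implicit Arguments. Unset Strict Implicit. Unset Printing Implicit Defensive.
Import Order.TTheory GRing.Theory Num.Theory.
Import numFieldNormedType.Exports.
Local Open Scope classical_set_scope.
Local Open Scope ring_scope.

Section Defs.
Variable R : realType.
Local Notation mu := (@lebesgue_measure R).
Local Notation lte := (fun a b : \bar R => (a < b)%E).

(* Vectors of R^n are column vectors 'cV[R]_n with the (max) norm `|.|;
   all norms on R^n are equivalent, so L^q membership and approximate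
   controllability do not depend on this choice. *)

Definition inLq (D : set R) (q : R) (n : nat) (f : R -> 'cV[R]_n) : Prop :=
  (forall i : 'I_n, measurable_fun D (fun s => f s i 0)) /\
  lte (\int[mu]_(s in D) ((powR `|f s|%R q)%:E))%E +oo%E.

Definition Lqnorm (D : set R) (q : R) (n : nat) (f : R -> 'cV[R]_n) : \bar R :=
  poweR (\int[mu]_(s in D) ((powR `|f s|%R q)%:E))%E q^-1.

Definition inLinf (D : set R) (n : nat) (g : R -> 'M[R]_n) : Prop :=
  (forall i j : 'I_n, measurable_fun D (fun s => g s i j)) /\
  exists M : R, {ae mu, forall s, D s -> `|g s| <= M}.

Definition rhs (d m N : nat) (Lam : nat -> R) (A : nat -> 'M[R]_d)
  (B : 'M[R]_(d, m)) (g : R -> 'M[R]_d) (u : R -> 'cV[R]_m)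
  (x : R -> 'cV[R]_d) (t : R) : 'cV[R]_d :=
  \sum_(1 <= j < N.+1) (A j *m x (t - Lam j))
  + \col_(i < d) (\sum_(k < d)
        Rintegral mu `[0, Lam N]%classic (fun s => g s i k * x (t - s) k 0))
  + B *m u t.

Definition is_solution (q : R) (d m N : nat) (Lam : nat -> R)
  (A : nat -> 'M[R]_d) (B : 'M[R]_(d, m)) (g : R -> 'M[R]_d) (T : R)
  (phi : R -> 'cV[R]_d) (u : R -> 'cV[R]_m) (x : R -> 'cV[R]_d) : Prop :=
  inLq `[- Lam N, T]%classic q x /\
  (forall t, `[- Lam N, 0]%classic t -> x t = phi t) /\
  {ae mu, forall t, `[0, T]%classic t -> x t = rhs N Lam A B g u x t}.

Definition approx_ctrl_time (q : R) (d m N : nat) (Lam : nat -> R)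
  (A : nat -> 'M[R]_d) (B : 'M[R]_(d, m)) (g : R -> 'M[R]_d) (T : R) : Prop :=
  forall psi : R -> 'cV[R]_d, inLq `[- Lam N, 0]%classic q psi ->
  forall eps : R, 0 < eps ->
  exists u : R -> 'cV[R]_m, inLq `[0, T]%classic q u /\
  exists x : R -> 'cV[R]_d, is_solution q N Lam A B g T (fun=> 0) u x /\
    lte (Lqnorm `[- Lam N, 0]%classic q (fun th => x (T + th) - psi th)) (eps%:E).

Definition approx_ctrl (q : R) (d m N : nat) (Lam : nat -> R)
  (A : nat -> 'M[R]_d) (B : 'M[R]_(d, m)) (g : R -> 'M[R]_d) : Prop :=
  forall psi : R -> 'cV[R]_d, inLq `[- Lam N, 0]%classic q psi ->
  forall eps : R, 0 < eps ->
  exists T : R, 0 < T /\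
  exists u : R -> 'cV[R]_m, inLq `[0, T]%classic q u /\
  exists x : R -> 'cV[R]_d, is_solution q N Lam A B g T (fun=> 0) u x /\
    lte (Lqnorm `[- Lam N, 0]%classic q (fun th => x (T + th) - psi th)) (eps%:E).

End Defs.

(* Main.v *)
(* Let [Q = 1 - \sum_j A_j S_j - g *] be the d x d matrix of convolution operators
   (delays [S_j] by [Lam j] and convolutions by the entries of [g]) acting on causal
   functions, so that a trajectory issued from the origin satisfies [Q x = B u].
   Delays and convolutions commute, hence [Q] has a determinant [p] and an adjugate,
   [Q \adj Q = p], and [\adj Q] delays by at most [(d - 1) Lam N]. Modulo operators
   that strictly delay or smooth, [p] is [1], so a Neumann series inverts it on every
   bounded time interval. Given a control [u] on [0, T1] with [T1 > T], take [z]
   supported in [0, T1 - T] with [p z = u] there. Then [x - \adj Q B z] is the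
   trajectory of the control [u - p z]; both vanish up to time [T1 - T], and the state
   at time [T1] is that of [x] as soon as [(d + 1) Lam N < T]. Thus every state
   reachable from the origin in time [T1] is exactly reachable in time [T]. *)
Require Import Defs.
From HB Require Import structures.
From mathcomp Require Import all_boot all_order all_algebra.
From mathcomp Require Import all_classical all_reals all_analysis.
From mathcomp Require Import measurable_realfun ring lra.
Set Implicit Arguments. Unset Strict Implicit. Unset Printing Implicit Defensive.
Import Order.TTheory GRing.Theory Num.Theory.
Import numFieldNormedType.Exports.
Local Open Scope classical_set_scope.
Local Open Scope ring_scope.

(** * Translations and almost everywhere statements *)

(** All estimates are made in L^1, on functions vanishing at negative times: Fubini applies there,
    and the weight exp(- lam t) makes strict delays and convolutions by bounded kernels arbitrarily
    small as [lam] grows. This yields the Neumann series and also uniqueness, which is why the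
    corrected trajectory Y vanishes up to T1 - T: with U' = u - p z its control, Q Y = B U'
    multiplied by \adj Q gives p Y = 0 there almost everywhere, and p is injective on such
    intervals. Local L^q integrability is carried alongside as a property of the operators. The
    Neumann series is summed in L^1 only; its limit is brought back to L^q by successive time steps
    no longer than the smallest delay. Determinants require strict commutativity, so the operators
    act on genuine functions, and their ring is a bicommutant rather than the polynomials in given
    delays and convolutions. Acting on genuine functions also lets supports be followed pointwise.
    The shorter trajectory is obtained from the longer one by operators alone, without a
    well-posedness theorem for the system. *)

Section Translation.
Variable R : realType.
Local Notation mu := (@lebesgue_measure R).

Lemma measurable_reflect (a : R) : measurable_fun setT (fun t : R => a - t).
Proof. exact: measurable_funB. Qed.

(** Lebesgue measure is determined by half-open intervals, and the preimage of []b, c]] is [[a - c,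
    a - b[], of the same length. Translation invariance of integrals then follows by composing two
    reflections. *)
Lemma lebesgue_measure_reflect (a : R) (A : set R) : measurable A ->
  pushforward mu ((fun t => a - t) : _ -> measurableTypeR R) A = mu A.
Proof.
move=> mA; pose phi : measurableTypeR R -> measurableTypeR R := fun t => a - t.
have mphi : measurable_fun setT phi by exact: measurable_reflect.
pose mix := isMeasurableFun.Build _ _ _ _ _ mphi.
pose phip : {mfun _ >-> _} := HB.pack phi mix.
rewrite [LHS](_ : _ = pushforward mu phip A)//.
apply/esym/lebesgue_measure_unique => //= _ [[b c]] _ <-.
rewrite /pushforward [X in _ = mu X](_ : _ = `[a - c, a - b[%classic); last first.
  apply/seteqP; split => t; rewrite /= /phi !in_itv/= => /andP[? ?];
      by apply/andP; split; lra.
rewrite !lebesgue_measure_itv/= !lte_fin.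
have -> : (a - c < a - b) = (b < c) by apply/idP/idP => ?; lra.
by case: ifPn => // _; rewrite -!EFinB; congr (_%:E); ring.
Qed.

Lemma ge0_integral_reflect (a : R) (f : R -> \bar R) :
  measurable_fun setT f -> (forall t, 0 <= f t)%E ->
  (\int[mu]_t f (a - t)%R = \int[mu]_t f t)%E.
Proof.
move=> mf f0; pose phi : measurableTypeR R -> measurableTypeR R := fun t => a - t.
have mphi : measurable_fun setT phi by exact: measurable_reflect.
transitivity (\int[pushforward mu phi]_t f t)%E.
  by rewrite (ge0_integral_pushforward mphi).
by apply: eq_measure_integral => //= A mA AS; exact: lebesgue_measure_reflect.
Qed.

Lemma ge0_integral_translate (a : R) (f : R -> \bar R) :
  measurable_fun setT f -> (forall t, 0 <= f t)%E ->
  (\int[mu]_t f (t - a)%R = \int[mu]_t f t)%E.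
Proof.
move=> mf f0; rewrite -[RHS](ge0_integral_reflect 0)//.
rewrite -[RHS](ge0_integral_reflect a)//.
  by apply: eq_integral => t _; congr f; ring.
by apply: measurableT_comp => //; exact: measurable_reflect.
Qed.

Lemma ae_translate (a : R) (P : R -> Prop) :
  {ae mu, forall t, P t} -> {ae mu, forall t, P (t + a)}.
Proof.
move=> [A [mA A0 sA]]; exists ((fun t => t + a) @^-1` A).
have mB : measurable ((fun t : R => t + a) @^-1` A).
  rewrite -[_ @^-1` _]setTI; apply: (measurable_funD _ _) => //.
split => //.
  rewrite -[X in mu X]setIT -integral_indic//.
  transitivity (\int[mu]_t (fun t => (\1_A t)%:E) (t - - a)%R)%E.
    by apply: eq_integral => t _; rewrite opprK /indic.
  rewrite (ge0_integral_translate (- a) (f := fun t => (\1_A t)%:E))//;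
    last exact/measurable_EFinP.
  by rewrite integral_indic// setIT.
by move=> t nP; apply: sA.
Qed.

Lemma ae_imp (P Q : R -> Prop) : (forall t, P t -> Q t) ->
  {ae mu, forall t, P t} -> {ae mu, forall t, Q t}.
Proof. by move=> PQ [A [mA A0 sA]]; exists A; split => // t nQ; apply: sA => /PQ. Qed.

Lemma ae_imp2 (P Q S : R -> Prop) : (forall t, P t -> Q t -> S t) ->
  {ae mu, forall t, P t} -> {ae mu, forall t, Q t} -> {ae mu, forall t, S t}.
Proof.
move=> PQS aP aQ; have := negligibleU aP aQ; apply: negligibleS => t nS.
by apply: contrapT => /not_orP[/contrapT ? /contrapT ?]; apply: nS; exact: PQS.
Qed.

Lemma ae_forall_ord n (P : R -> 'I_n -> Prop) :
  (forall i, {ae mu, forall t, P t i}) -> {ae mu, forall t, forall i, P t i}.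
Proof.
move=> aP; have : forall r : seq 'I_n, {ae mu, forall t, forall i, i \in r -> P t i}.
  elim=> [|i r IH]; first by apply: aeW => t i; rewrite in_nil.
  apply: ae_imp2 (aP i) IH => t h1 h2 j; rewrite inE => /orP[/eqP ->//|].
  exact: h2.
move=> /(_ (enum 'I_n)); apply: ae_imp => t h i; apply: h.
by rewrite mem_enum.
Qed.

Lemma ge0_le_integral_EFin (f g : R -> R) : (forall t, 0 <= f t) ->
  measurable_fun setT f -> measurable_fun setT g -> (forall t, f t <= g t) ->
  (\int[mu]_t (f t)%:E <= \int[mu]_t (g t)%:E)%E.
Proof.
move=> f0 mf mg fg; apply: ge0_le_integral => //.
- by move=> t _; rewrite lee_fin.
- exact/measurable_EFinP.
- exact/measurable_EFinP.
- by move=> t _; rewrite lee_fin.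
Qed.

End Translation.

(** * Exponentially weighted L^1 norms *)

Section Weighted.
Variable R : realType.
Local Notation mu := (@lebesgue_measure R).
Implicit Types (x y k : R -> R) (lam tau L M : R).

(** Vanishing is required at every negative time, not almost everywhere. Integrability is global:
    trajectories are truncated to a bounded interval before entering this class. *)
Definition causal_integrable x :=
  mu.-integrable setT (EFin \o x) /\ forall t, t < 0 -> x t = 0.

Lemma causal_integrable_measurable x :
  causal_integrable x -> measurable_fun setT x.
Proof. by move=> [/measurable_int/measurable_EFinP]. Qed.

(** The stop at [tau] lets norm bounds express causality: the output up to [tau] is estimated by the
    input up to [tau]. *)
Definition weight lam tau x t :=
  if t <= tau then expR (- (lam * t)) * `|x t| else 0.

Definition wnorm lam tau x : \bar R := (\int[mu]_t (weight lam tau x t)%:E)%E.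

Lemma weight_ge0 lam tau x t : 0 <= weight lam tau x t.
Proof. by rewrite /weight; case: ifP => // _; rewrite mulr_ge0// expR_ge0. Qed.

Lemma wnorm_ge0 lam tau x : (0 <= wnorm lam tau x)%E.
Proof. by apply: integral_ge0 => t _; rewrite lee_fin weight_ge0. Qed.

Lemma measurable_exp_weight lam : measurable_fun setT (fun t : R => expR (- (lam * t))).
Proof.
by apply: measurableT_comp => //; apply: measurableT_comp => //;
  exact: measurable_funM.
Qed.

Lemma measurable_weight lam tau x : measurable_fun setT x ->
  measurable_fun setT (weight lam tau x).
Proof.
move=> mx; apply: measurable_fun_ifT => //; first exact: measurable_fun_ler.
by apply: measurable_funM; [exact: measurable_exp_weight|exact: measurableT_comp].
Qed.

Lemma measurable_EFin_weight lam tau x : measurable_fun setT x ->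
  measurable_fun setT (fun t => (weight lam tau x t)%:E).
Proof. by move=> mx; apply/measurable_EFinP; exact: measurable_weight. Qed.

Lemma measurable_translate x a : measurable_fun setT x ->
  measurable_fun setT (fun t : R => x (t - a)).
Proof. by move=> mx; apply: measurableT_comp => //; exact: measurable_funB. Qed.

Lemma weight_delay lam tau L x t : 0 <= L ->
  weight lam tau (fun t : R => x (t - L)) t
    <= expR (- (lam * L)) * weight lam tau x (t - L).
Proof.
move=> L0; rewrite /weight; case: ifPn => tt; last first.
  by case: ifP => _; rewrite ?mulr0// !mulr_ge0// expR_ge0.
rewrite ifT; last by lra.
by rewrite mulrA -expRD le_eqVlt; apply/orP; left; apply/eqP; congr (expR _ * _); ring.
Qed.

Lemma wnorm_delay lam tau L x : measurable_fun setT x -> 0 <= L ->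
  (wnorm lam tau (fun t : R => x (t - L)%R)
     <= (expR (- (lam * L)))%:E * wnorm lam tau x)%E.
Proof.
move=> mx L0; rewrite /wnorm.
rewrite -(ge0_integral_translate L (f := fun t => (weight lam tau x t)%:E)).
- rewrite -ge0_integralZl_EFin//.
  + apply: ge0_le_integral => //.
    * by move=> t _; rewrite lee_fin weight_ge0.
    * by apply: measurable_EFin_weight; exact: measurable_translate.
    * apply/measurable_EFinP; apply: measurable_funM => //.
      by apply: measurable_translate; exact: measurable_weight.
    * by move=> t _; rewrite lee_fin weight_delay.
  + by move=> t _; rewrite lee_fin weight_ge0.
  + by apply/measurable_EFinP; apply: measurable_translate; exact: measurable_weight.
- exact: measurable_EFin_weight.
- by move=> t; rewrite lee_fin weight_ge0.
Qed.

Lemma wnorm_scale lam tau c x : measurable_fun setT x ->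
  wnorm lam tau (fun t : R => c * x t) = (`|c|%:E * wnorm lam tau x)%E.
Proof.
move=> mx; rewrite /wnorm -ge0_integralZl_EFin//.
- apply: eq_integral => t _; rewrite -EFinM; congr (_%:E).
  by rewrite /weight; case: ifP => _; rewrite ?mulr0// normrM; ring.
- by move=> t _; rewrite lee_fin weight_ge0.
- exact: measurable_EFin_weight.
Qed.

Lemma wnorm_triangle lam tau x y : measurable_fun setT x -> measurable_fun setT y ->
  (wnorm lam tau (x \+ y)%R <= wnorm lam tau x + wnorm lam tau y)%E.
Proof.
move=> mx my; rewrite /wnorm -ge0_integralD//.
- apply: ge0_le_integral => //.
  + by move=> t _; rewrite lee_fin weight_ge0.
  + by apply: measurable_EFin_weight; exact: measurable_funD.
  + by apply: emeasurable_funD; exact: measurable_EFin_weight.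
  + move=> t _; rewrite -EFinD lee_fin /weight; case: ifP => _; rewrite ?addr0//.
    by rewrite -mulrDr ler_wpM2l ?expR_ge0// ler_normD.
- by move=> t _; rewrite lee_fin weight_ge0.
- exact: measurable_EFin_weight.
- by move=> t _; rewrite lee_fin weight_ge0.
- exact: measurable_EFin_weight.
Qed.

Lemma wnorm_le_norm lam tau x : causal_integrable x -> 0 <= lam ->
  (wnorm lam tau x <= \int[mu]_t (`|x t|)%:E)%E.
Proof.
move=> Vx lam0; have mx := causal_integrable_measurable Vx.
apply: ge0_le_integral => //.
- by move=> t _; rewrite lee_fin weight_ge0.
- exact: measurable_EFin_weight.
- by apply/measurable_EFinP; exact: measurableT_comp.
- move=> t _; rewrite lee_fin /weight; case: ifP => // _.
  have [t0|t0] := ltP t 0; first by rewrite Vx.2// normr0 mulr0.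
  by rewrite ler_piMl// -expR0 ler_expR oppr_le0 mulr_ge0.
Qed.

Lemma wnorm_lty lam tau x : causal_integrable x -> 0 <= lam ->
  (wnorm lam tau x < +oo)%E.
Proof.
move=> Vx lam0; apply: le_lt_trans (wnorm_le_norm tau Vx lam0) _.
by have [/integrableP[_ /=]] := Vx.
Qed.

Lemma wnorm_fin_num lam tau x : causal_integrable x -> 0 <= lam ->
  wnorm lam tau x \is a fin_num.
Proof. by move=> Vx lam0; rewrite ge0_fin_numE ?wnorm_ge0// wnorm_lty. Qed.

(** For [t <= tau] the factor exp(lam (tau - t)) is at least 1. This converts smallness for a large
    weight into smallness in truncated L^1. *)
Lemma wnorm0_le_wnorm lam tau x : measurable_fun setT x -> 0 <= lam ->
  (wnorm 0 tau x <= (expR (lam * tau))%:E * wnorm lam tau x)%E.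
Proof.
move=> mx lam0; rewrite -ge0_integralZl_EFin//.
- apply: ge0_le_integral => //.
  + by move=> t _; rewrite lee_fin weight_ge0.
  + exact: measurable_EFin_weight.
  + by apply/measurable_EFinP; apply: measurable_funM => //; exact: measurable_weight.
  + move=> t _; rewrite lee_fin /weight; case: ifP => [tt|]; rewrite ?mulr0//.
    rewrite mulrA ler_wpM2r// -expRD ler_expR mul0r oppr0 -mulrBr mulr_ge0//.
    by lra.
- by move=> t _; rewrite lee_fin weight_ge0.
- exact: measurable_EFin_weight.
Qed.

Lemma wnorm_eq0P lam tau x : measurable_fun setT x ->
  wnorm lam tau x = 0%E <-> {ae mu, forall t, t <= tau -> x t = 0}.
Proof.
move=> mx; have -> : wnorm lam tau x = (\int[mu]_t `|(weight lam tau x t)%:E|)%E.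
  by apply: eq_integral => t _; rewrite gee0_abs// lee_fin weight_ge0.
rewrite ae_eq_integral_abs//; last exact: measurable_EFin_weight.
split; apply: ae_imp => t /= xt.
  move=> tt; have := xt I; rewrite /weight tt => -[] /eqP.
  by rewrite mulf_eq0 gt_eqF ?expR_gt0//= normr_eq0 => /eqP.
by move=> _; rewrite /weight; case: ifP => // tt; rewrite xt// normr0 mulr0.
Qed.

End Weighted.

(** * Convolution with a bounded compactly supported kernel *)

Section Convolution.
Variable R : realType.
Local Notation mu := (@lebesgue_measure R).
Implicit Types (x y k : R -> R) (lam tau L M : R).

Definition bounded_kernel L M k :=
  [/\ measurable_fun setT k, forall s, `|k s| <= M
    & forall s, ~~ (0 <= s <= L) -> k s = 0].

Definition convol k x t : R := (\int[mu]_s (k s * x (t - s)))%R.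

Lemma integral_norm_reflect x t : measurable_fun setT x ->
  (\int[mu]_s (`|x (t - s)%R|)%:E = \int[mu]_s (`|x s|)%:E)%E.
Proof.
move=> mx; rewrite (ge0_integral_reflect t (f := fun s => (`|x s|)%:E))//.
by apply/measurable_EFinP; exact: measurableT_comp.
Qed.

Lemma integrable_reflect x t : mu.-integrable setT (EFin \o x) ->
  mu.-integrable setT (fun s => (x (t - s))%:E).
Proof.
move=> /integrableP[/measurable_EFinP mx xoo]; apply/integrableP; split.
  by apply/measurable_EFinP; apply: measurableT_comp => //; exact: measurable_reflect.
by under eq_integral do rewrite abse_EFin; rewrite integral_norm_reflect.
Qed.

Lemma integrable_convol_integrand L M k x t : bounded_kernel L M k ->
  mu.-integrable setT (EFin \o x) ->
  mu.-integrable setT (fun s => (k s * x (t - s))%:E).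
Proof.
move=> [mk kM _] /(integrable_reflect t) ix.
apply: (le_integrable measurableT _ _ (integrableZl measurableT M ix)).
  apply/measurable_EFinP; apply: measurable_funM => //.
  by move: ix => /measurable_int/measurable_EFinP.
move=> s _; rewrite -EFinM !abse_EFin lee_fin !normrM ler_wpM2r//.
exact: le_trans (kM s) (ler_norm _).
Qed.

Lemma EFin_convol L M k x t : bounded_kernel L M k ->
  mu.-integrable setT (EFin \o x) ->
  (convol k x t)%:E = (\int[mu]_s (k s * x (t - s))%:E)%E.
Proof.
move=> kk ix; rewrite /convol /Rintegral fineK//.
by apply: integrable_fin_num => //; exact: integrable_convol_integrand kk ix.
Qed.

Lemma measurable_sub_pair x : measurable_fun setT x ->
  measurable_fun setT (fun p : R * R => x (p.1 - p.2)).
Proof. by move=> mx; apply: measurableT_comp => //; exact: measurable_funB. Qed.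

(** A bounded kernel sends L^1 to bounded functions. Hence convolutions have locally L^q values even
    when their argument is only integrable. *)
Lemma norm_convol_le L M k x t : bounded_kernel L M k ->
  mu.-integrable setT (EFin \o x) ->
  `|convol k x t| <= M * fine (\int[mu]_s (`|x s|)%:E)%E.
Proof.
move=> kk ix; have [mk kM _] := kk.
have /integrableP[/measurable_EFinP mx xoo] := ix.
have M0 : 0 <= M := le_trans (normr_ge0 _) (kM 0).
rewrite -lee_fin EFinM fineK; last first.
  by rewrite ge0_fin_numE//; apply: integral_ge0 => s _; rewrite lee_fin.
rewrite -abse_EFin (EFin_convol t kk ix) -(integral_norm_reflect t mx).
have ii := integrable_convol_integrand t kk ix.
apply: le_trans (le_abse_integral _ _ _) _ => //; first exact: measurable_int ii.
have mxt : measurable_fun setT (fun s : R => `|x (t - s)|).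
  apply: measurableT_comp => //; apply: measurableT_comp => //.
  exact: measurable_reflect.
rewrite -ge0_integralZl_EFin//; last exact/measurable_EFinP.
under eq_integral do rewrite abse_EFin.
under [leRHS]eq_integral do rewrite -EFinM.
apply: ge0_le_integral_EFin => //.
- apply: measurableT_comp => //; apply: measurable_funM => //.
  apply: measurableT_comp => //; exact: measurable_reflect.
- by apply: measurable_funM.
- by move=> s; rewrite normrM ler_wpM2r.
Qed.

Lemma integral_indic_itvcc (a b : R) : a <= b ->
  (\int[mu]_t (\1_`[a, b] t)%:E = (b - a)%:E)%E.
Proof.
move=> ab; rewrite integral_indic//= setIT.
rewrite lebesgue_measure_itv/= lte_fin; case: ltP => [_|ba]; first by rewrite EFinB.
by congr (_%:E); apply/eqP; rewrite eq_sym subr_eq0 eq_le ab ba.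
Qed.

(** For a kernel carried by nonnegative times this is the Laplace transform of |k| at [lam], the
    factor by which convolution acts on the weighted norm. *)
Definition kernel_mass lam k := (\int[mu]_s (`|k s| * expR (- (lam * s)))%:E)%E.

(** The part on [0, delta] contributes at most M delta; beyond [delta] the weight is at most exp(-
    lam delta), on a set of length at most L. A small [delta] followed by a large [lam] makes the
    bound as small as desired. *)
Lemma kernel_mass_le lam L M k delta : bounded_kernel L M k -> 0 <= L ->
  0 <= lam -> 0 <= delta ->
  (kernel_mass lam k <= (M * (delta + expR (- (lam * delta)) * L))%:E)%E.
Proof.
move=> [mk kM k0] L0 lam0 d0.
have M0 : 0 <= M := le_trans (normr_ge0 _) (kM 0).
pose e := expR (- (lam * delta)).
have e0 : 0 <= e by rewrite expR_ge0.
apply: (@le_trans _ _ (\int[mu]_s (M%:E * (\1_`[0, delta] s)%:E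
    + (M * e)%:E * (\1_`[0, L] s)%:E))%E).
  apply: ge0_le_integral => //.
  - apply/measurable_EFinP; apply: measurable_funM; last exact: measurable_exp_weight.
    exact: measurableT_comp.
  - by apply: emeasurable_funD; apply/measurable_EFinP; apply: measurable_funM => //.
  - move=> s _; rewrite -!EFinM -EFinD lee_fin !indicE.
    have [s0|s0] := boolP (0 <= s <= L); last first.
      by rewrite k0// normr0 mul0r addr_ge0// !mulr_ge0.
    have -> : (s \in `[0, L]%classic) = true by apply/mem_set; rewrite /= in_itv.
    have [sd|sd] := leP s delta.
      have -> : (s \in `[0, delta]%classic) = true.
        by apply/mem_set; rewrite /= in_itv/= sd andbT; case/andP: s0.
      rewrite !mulr1 -[leLHS]addr0 lerD// ?mulr_ge0//.
      rewrite -[leRHS]mulr1 ler_pM ?expR_ge0// -expR0 ler_expR oppr_le0 mulr_ge0//.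
      by case/andP: s0.
    rewrite mulr1 -[leLHS]add0r lerD// ?mulr_ge0// ler_pM ?expR_ge0//.
    by rewrite ler_expR lerN2 ler_wpM2l// ltW.
rewrite ge0_integralD//; last 4 first.
- by move=> s _; rewrite mule_ge0// lee_fin.
- by apply/measurable_EFinP; apply: measurable_funM.
- by move=> s _; rewrite mule_ge0// lee_fin// mulr_ge0.
- by apply/measurable_EFinP; apply: measurable_funM.
rewrite !ge0_integralZl_EFin ?mulr_ge0//; try first
  [exact/measurable_EFinP|by move=> ? _; rewrite lee_fin].
rewrite !integral_indic_itvcc// !subr0.
by rewrite -!EFinM -EFinD lee_fin -/e mulrDr mulrA.
Qed.

Lemma kernel_mass_lty lam L M k : bounded_kernel L M k -> 0 <= L -> 0 <= lam ->
  (kernel_mass lam k < +oo)%E.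
Proof. by move=> kk L0 l0; apply: le_lt_trans (kernel_mass_le kk L0 l0 (lexx 0)) (ltry _). Qed.

Lemma integrable_convol_pair L M k x : bounded_kernel L M k -> 0 <= L ->
  mu.-integrable setT (EFin \o x) ->
  (mu \x mu)%E.-integrable setT (fun p : R * R => (k p.2 * x (p.1 - p.2))%:E).
Proof.
move=> kk L0 ix; have [mk kM k0] := kk.
have /integrableP[/measurable_EFinP mx xoo] := ix.
have mF : measurable_fun setT (fun p : R * R => (k p.2 * x (p.1 - p.2))%:E).
  apply/measurable_EFinP; apply: measurable_funM; last exact: measurable_sub_pair.
  exact: (measurableT_comp mk).
apply/(integrable21ltyP mu mu mF).
have nx0 : (0 <= \int[mu]_t (`|x t|)%:E)%E by apply: integral_ge0 => t _; rewrite lee_fin.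
rewrite [ltLHS](_ : _ = \int[mu]_s ((`|k s|)%:E * \int[mu]_t (`|x t|)%:E))%E; last first.
  apply: eq_integral => s _ /=; under eq_integral do rewrite normrM EFinM.
  rewrite ge0_integralZl_EFin//.
  - congr (_ * _)%E.
    rewrite (ge0_integral_translate s (f := fun t => (`|x t|)%:E))//.
    by apply/measurable_EFinP; exact: measurableT_comp.
  - apply/measurable_EFinP; apply: measurableT_comp => //.
    exact: measurable_translate.
rewrite ge0_integralZr//; last by apply/measurable_EFinP; exact: measurableT_comp.
have -> : (\int[mu]_s (`|k s|)%:E = kernel_mass 0 k)%E.
  by apply: eq_integral => s _; rewrite mul0r oppr0 expR0 mulr1.
have k0' : (0 <= kernel_mass 0 k)%E.
  by apply: integral_ge0 => s _; rewrite lee_fin mulr_ge0// expR_ge0.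
apply: lte_mul_pinfty => //.
by rewrite ge0_fin_numE//; exact: kernel_mass_lty kk L0 _.
Qed.

Lemma causal_integrable_convol L M k x : bounded_kernel L M k -> 0 <= L ->
  causal_integrable x -> causal_integrable (convol k x).
Proof.
move=> kk L0 [ix x0]; have [mk kM k0] := kk; split.
  rewrite (_ : _ \o _ = fubini_F mu (fun p : R * R => (k p.2 * x (p.1 - p.2))%:E)).
    exact: integrable_fubini_F (integrable_convol_pair kk L0 ix).
  by apply/funext => t; exact: EFin_convol kk ix.
move=> t t0; rewrite /convol /Rintegral integral0_eq// => s _.
have [/andP[s0 _]|s0] := boolP (0 <= s <= L); last by rewrite k0// mul0r.
by rewrite x0 ?mulr0//; lra.
Qed.

(** Young's inequality for L^1: the weight splits as exp(- lam s) exp(- lam (t - s)) and Tonelli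
    separates the factors. The cut at [tau] survives because the kernel lives on [s >= 0], so that
    [t - s <= tau]. *)
Lemma wnorm_convol lam tau L M k x : bounded_kernel L M k -> 0 <= L ->
  causal_integrable x ->
  (wnorm lam tau (convol k x) <= kernel_mass lam k * wnorm lam tau x)%E.
Proof.
move=> kk L0 Vx; have [ix x0] := Vx; have mx := causal_integrable_measurable Vx.
have [mk kM k0] := kk.
pose c s := `|k s| * expR (- (lam * s)).
have c0 s : 0 <= c s by rewrite mulr_ge0// expR_ge0.
have mc : measurable_fun setT c.
  by apply: measurable_funM; [exact: measurableT_comp|exact: measurable_exp_weight].
pose F (p : R * R) := (c p.2 * weight lam tau x (p.1 - p.2))%:E.
have mF : measurable_fun setT F.
  apply/measurable_EFinP; apply: measurable_funM.
    exact: (measurableT_comp mc).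
  by apply: measurable_sub_pair; exact: measurable_weight.
have F0 p : (0 <= F p)%E by rewrite lee_fin mulr_ge0// weight_ge0.
have wF t : ((weight lam tau (convol k x) t)%:E <= \int[mu]_s F (t, s))%E.
  rewrite {1}/weight; case: ifPn => tt; last by apply: integral_ge0.
  have ii := integrable_convol_integrand t kk ix.
  have mi := measurable_int _ ii.
  rewrite EFinM -abse_EFin (EFin_convol t kk ix).
  apply: (@le_trans _ _ ((expR (- (lam * t)))%:E * \int[mu]_s `|(k s * x (t - s))%:E|)%E).
    by rewrite lee_wpmul2l ?lee_fin ?expR_ge0//; exact: le_abse_integral.
  rewrite -ge0_integralZl_EFin//; last exact: measurableT_comp.
  rewrite le_eqVlt; apply/orP; left; apply/eqP; apply: eq_integral => s _.
  rewrite /F /= -EFinM; congr (_%:E).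
  have [s0|s0] := boolP (0 <= s <= L); last by rewrite /c k0// mul0r normr0 mulr0 !mul0r.
  rewrite /weight ifT; last by move: s0 => /andP[? _]; lra.
  rewrite /c normrM.
  rewrite (_ : - (lam * t) = - (lam * s) + - (lam * (t - s))); last by ring.
  by rewrite expRD; ring.
apply: (@le_trans _ _ (\int[mu]_t \int[mu]_s F (t, s))%E).
  apply: ge0_le_integral => //.
  - by move=> t _; rewrite lee_fin weight_ge0.
  - apply: measurable_EFin_weight.
    exact: causal_integrable_measurable (causal_integrable_convol kk L0 Vx).
  - exact: measurable_fun_fubini_tonelli_F.
rewrite fubini_tonelli//.
under eq_integral => s _.
  rewrite (_ : (\int[mu]_t _)%E = ((c s)%:E * wnorm lam tau x)%E); last first.
    under eq_integral do rewrite /F /= EFinM.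
    rewrite ge0_integralZl_EFin//.
    - congr (_ * _)%E.
      rewrite (ge0_integral_translate s (f := fun t => (weight lam tau x t)%:E))//;
        [exact: measurable_EFin_weight|by move=> t; rewrite lee_fin weight_ge0].
    - by move=> t _; rewrite lee_fin weight_ge0.
    - by apply/measurable_EFinP; apply: measurable_translate; exact: measurable_weight.
  over.
rewrite ge0_integralZr// ?wnorm_ge0//.
  exact/measurable_EFinP.
by move=> s _; rewrite lee_fin.
Qed.

Lemma convolB L M k x y t : bounded_kernel L M k ->
  causal_integrable x -> causal_integrable y ->
  convol k (fun t => x t - y t) t = convol k x t - convol k y t.
Proof.
move=> kk [ix _] [iy _]; rewrite /convol -RintegralB//.
- by apply: eq_Rintegral => s _; rewrite mulrBr.
- exact: integrable_convol_integrand kk ix.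
- exact: integrable_convol_integrand kk iy.
Qed.

Lemma convol_scale L M k x c t : bounded_kernel L M k -> causal_integrable x ->
  convol k (fun t => c * x t) t = c * convol k x t.
Proof.
move=> kk [ix _]; rewrite /convol -RintegralZl//.
  by apply: eq_Rintegral => s _; rewrite mulrCA.
exact: integrable_convol_integrand kk ix.
Qed.

Lemma convol_delay k x a t :
  convol k (fun t => x (t - a)) t = convol k x (t - a).
Proof. by apply: eq_Rintegral => s _; congr (_ * x _); ring. Qed.

Lemma convol_eq0_after L M k x tau t : bounded_kernel L M k ->
  (forall t, tau < t -> x t = 0) -> tau + L < t -> convol k x t = 0.
Proof.
move=> [_ _ k0] x0 tt; rewrite /convol /Rintegral integral0_eq// => s _.
have [/andP[_ s0]|s0] := boolP (0 <= s <= L); last by rewrite k0// mul0r.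
by rewrite x0 ?mulr0//; lra.
Qed.

(** Fubini at fixed [t] for k1(s) k2(r) x(t - s - r), whose integral is dominated using the bound on
    [k2] and the L^1 norms of [k1] and [x]. The equality holds at every [t], as strict commutativity
    of the operators demands. *)
Lemma convolC L1 M1 k1 L2 M2 k2 x t : bounded_kernel L1 M1 k1 ->
  bounded_kernel L2 M2 k2 -> 0 <= L1 -> 0 <= L2 -> causal_integrable x ->
  convol k1 (convol k2 x) t = convol k2 (convol k1 x) t.
Proof.
move=> kk1 kk2 L10 L20 Vx; have [ix _] := Vx.
have [mk1 kM1 _] := kk1; have [mk2 kM2 _] := kk2.
have mx := causal_integrable_measurable Vx.
pose F (p : R * R) := (k1 p.1 * (k2 p.2 * x (t - p.1 - p.2)))%:E.
have mF : measurable_fun setT F.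
  apply/measurable_EFinP; apply: measurable_funM; first exact: (measurableT_comp mk1).
  apply: measurable_funM; first exact: (measurableT_comp mk2).
  apply: (measurableT_comp mx); apply: measurable_funB => //.
  exact: (measurableT_comp (measurable_reflect t)).
have nx0 : (0 <= \int[mu]_r (`|x r|)%:E)%E by apply: integral_ge0 => r _; rewrite lee_fin.
have M20 : 0 <= M2 := le_trans (normr_ge0 _) (kM2 0).
have nxfin : (M2%:E * \int[mu]_r (`|x r|)%:E < +oo)%E.
  apply: lte_mul_pinfty; rewrite ?lee_fin//.
  by have /integrableP[] := ix.
have iF : (mu \x mu)%E.-integrable setT F.
  apply/(integrable12ltyP mu mu mF).
  apply: (@le_lt_trans _ _
    (\int[mu]_s ((`|k1 s|)%:E * (M2%:E * \int[mu]_r (`|x r|)%:E)))%E).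
    apply: ge0_le_integral => //.
    - by move=> s _; exact: integral_ge0.
    - have maF : measurable_fun setT (abse \o F) by exact: measurableT_comp.
      by apply: (@measurable_fun_fubini_tonelli_F _ _ _ _ _ mu _ maF) => p; exact: abse_ge0.
    - apply: emeasurable_funM => //.
      by apply/measurable_EFinP; exact: measurableT_comp.
    - move=> s _; rewrite -(integral_norm_reflect (t - s) mx).
      have mxs : measurable_fun setT (fun r : R => `|x (t - s - r)|).
        apply: measurableT_comp => //; apply: (measurableT_comp mx).
        exact: measurable_reflect.
      rewrite -!ge0_integralZl_EFin//; last first.
        exact/measurable_EFinP.
        by apply: emeasurable_funM => //; exact/measurable_EFinP.
        by move=> r _; rewrite mule_ge0// lee_fin.
      apply: ge0_le_integral => //.
      + by apply: measurableT_comp => //; exact: measurable_fun_pair2.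
      + apply: emeasurable_funM => //; apply: emeasurable_funM => //.
        exact/measurable_EFinP.
      + move=> r _; rewrite /F /= -!EFinM lee_fin !normrM ler_wpM2l//.
        by rewrite ler_wpM2r.
  rewrite ge0_integralZr//; last 2 first.
    by apply/measurable_EFinP; exact: measurableT_comp.
    by rewrite mule_ge0// lee_fin.
  have k10 : (0 <= \int[mu]_s (`|k1 s|)%:E)%E by apply: integral_ge0 => s _; rewrite lee_fin.
  apply: lte_mul_pinfty => //; rewrite ge0_fin_numE//.
  have -> : (\int[mu]_s (`|k1 s|)%:E = kernel_mass 0 k1)%E.
    by apply: eq_integral => s _; rewrite mul0r oppr0 expR0 mulr1.
  exact: kernel_mass_lty kk1 _ _.
apply: EFin_inj.
have [iy1 _] := causal_integrable_convol kk1 L10 Vx.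
have [iy2 _] := causal_integrable_convol kk2 L20 Vx.
rewrite (EFin_convol t kk1 iy2) (EFin_convol t kk2 iy1).
transitivity (\int[mu]_s \int[mu]_r F (s, r))%E.
  apply: eq_integral => s _; rewrite EFinM (EFin_convol (t - s) kk2 ix) -integralZl//.
  exact: integrable_convol_integrand kk2 ix.
rewrite Fubini//; apply: eq_integral => r _.
rewrite EFinM (EFin_convol (t - r) kk1 ix) -integralZl//.
  apply: eq_integral => s _; rewrite /F /= -EFinM; congr (_%:E).
  by rewrite mulrCA; congr (_ * (_ * x _)); ring.
exact: integrable_convol_integrand kk1 ix.
Qed.

End Convolution.

(** * Local L^q integrability *)

Section LocalLq.
Variable R : realType.
Local Notation mu := (@lebesgue_measure R).
Implicit Types (x y k : R -> R) (q tau L M : R).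

Definition lq_density q tau x t := if t <= tau then `|x t| `^ q else 0.

Definition Lq_upto q tau x := (\int[mu]_t (lq_density q tau x t)%:E < +oo)%E.

Lemma lq_density_ge0 q tau x t : 0 <= lq_density q tau x t.
Proof. by rewrite /lq_density; case: ifP => // _; rewrite powR_ge0. Qed.

Lemma measurable_lq_density q tau x : measurable_fun setT x ->
  measurable_fun setT (lq_density q tau x).
Proof.
move=> mx; apply: measurable_fun_ifT => //; first exact: measurable_fun_ler.
by apply: (measurableT_comp (@measurable_powR R q)); exact: measurableT_comp.
Qed.

(** From a + b <= 2 max(a, b). The constant is crude, but only finiteness of integrals is at
    stake. *)
Lemma powRD_le q (a b : R) : 0 <= q -> 0 <= a -> 0 <= b ->
  (a + b) `^ q <= 2 `^ q * (a `^ q + b `^ q).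
Proof.
move=> q0; wlog ab : a b / a <= b => [H|] a0 b0.
  by have [/H|/ltW/H] := leP a b; last rewrite addrC [X in _ * X]addrC; exact.
apply: (@le_trans _ _ ((2 * b) `^ q)).
  by rewrite ge0_ler_powR ?nnegrE ?addr_ge0 ?mulr_ge0//; lra.
by rewrite powRM// ler_wpM2l ?powR_ge0// lerDr powR_ge0.
Qed.

Lemma Lq_uptoD q tau x y : 0 <= q -> measurable_fun setT x -> measurable_fun setT y ->
  Lq_upto q tau x -> Lq_upto q tau y -> Lq_upto q tau (fun t => x t + y t).
Proof.
move=> q0 mx my Lx Ly; apply: (@le_lt_trans _ _ (\int[mu]_t
  ((2 `^ q)%:E * ((lq_density q tau x t)%:E + (lq_density q tau y t)%:E)))%E).
  apply: ge0_le_integral => //.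
  - by move=> t _; rewrite lee_fin lq_density_ge0.
  - by apply/measurable_EFinP; apply: measurable_lq_density; exact: measurable_funD.
  - apply: emeasurable_funM => //; apply: emeasurable_funD;
      by apply/measurable_EFinP; exact: measurable_lq_density.
  - move=> t _; rewrite -EFinD -EFinM lee_fin /lq_density.
    case: ifP => _; last by rewrite addr0 mulr0.
    apply: le_trans (powRD_le q0 (normr_ge0 _) (normr_ge0 _)).
    by rewrite ge0_ler_powR ?nnegrE ?addr_ge0// ler_normD.
rewrite ge0_integralZl_EFin ?powR_ge0//; last 2 first.
- by move=> t _; rewrite adde_ge0// lee_fin lq_density_ge0.
- by apply: emeasurable_funD; apply/measurable_EFinP; exact: measurable_lq_density.
apply: lte_mul_pinfty; rewrite ?lee_fin ?powR_ge0//.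
rewrite ge0_integralD//; first exact: lte_add_pinfty.
- by move=> t _; rewrite lee_fin lq_density_ge0.
- by apply/measurable_EFinP; exact: measurable_lq_density.
- by move=> t _; rewrite lee_fin lq_density_ge0.
- by apply/measurable_EFinP; exact: measurable_lq_density.
Qed.

Lemma Lq_upto_scale q tau c x : measurable_fun setT x ->
  Lq_upto q tau x -> Lq_upto q tau (fun t => c * x t).
Proof.
move=> mx Lx; rewrite /Lq_upto.
rewrite [ltLHS](_ : _ = \int[mu]_t ((`|c| `^ q)%:E * (lq_density q tau x t)%:E))%E.
  rewrite ge0_integralZl_EFin ?powR_ge0//.
  - by apply: lte_mul_pinfty; rewrite ?lee_fin ?powR_ge0.
  - by move=> t _; rewrite lee_fin lq_density_ge0.
  - by apply/measurable_EFinP; exact: measurable_lq_density.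
apply: eq_integral => t _; rewrite -EFinM; congr (_%:E); rewrite /lq_density.
by case: ifP => _; rewrite ?mulr0// normrM powRM.
Qed.

Lemma Lq_upto_le q tau tau' x : measurable_fun setT x -> tau' <= tau ->
  Lq_upto q tau x -> Lq_upto q tau' x.
Proof.
move=> mx tt; apply: le_lt_trans; apply: ge0_le_integral_EFin.
- exact: lq_density_ge0.
- exact: measurable_lq_density.
- exact: measurable_lq_density.
- move=> t; rewrite {1}/lq_density; case: ifP => [tt'|_]; last exact: lq_density_ge0.
  by rewrite /lq_density (le_trans tt' tt).
Qed.

Lemma Lq_upto_delay q tau L x : measurable_fun setT x ->
  Lq_upto q tau x -> Lq_upto q (tau + L) (fun t => x (t - L)).
Proof.
move=> mx Lx; rewrite /Lq_upto.
have -> : (\int[mu]_t (lq_density q (tau + L) (fun t : R => x (t - L)%R) t)%:E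
  = \int[mu]_t (lq_density q tau x (t - L)%R)%:E)%E.
  by apply: eq_integral => t _; rewrite /lq_density lerBlDr.
rewrite (ge0_integral_translate L (f := fun t => (lq_density q tau x t)%:E))//.
- by apply/measurable_EFinP; exact: measurable_lq_density.
- by move=> t; rewrite lee_fin lq_density_ge0.
Qed.

Lemma Lq_upto_bounded q tau M x : 0 < q -> measurable_fun setT x ->
  (forall t, `|x t| <= M) -> (forall t, t < 0 -> x t = 0) -> Lq_upto q tau x.
Proof.
move=> q0 mx xM x0; have M0 : 0 <= M := le_trans (normr_ge0 _) (xM 0).
apply: (@le_lt_trans _ _ (\int[mu]_t (M `^ q * \1_`[0, tau] t)%:E)%E).
  apply: ge0_le_integral_EFin.
  - exact: lq_density_ge0.
  - exact: measurable_lq_density.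
  - by apply: measurable_funM => //; exact: measurable_indic.
  - move=> t; rewrite /lq_density; case: ifP => tt; last by rewrite mulr_ge0// powR_ge0.
    have [t0|t0] := ltP t 0.
      by rewrite x0// normr0 powR0 ?gt_eqF// mulr_ge0// powR_ge0.
    rewrite indicE mem_set ?mulr1; last by rewrite /= in_itv/= t0 tt.
    by rewrite ge0_ler_powR ?nnegrE// ltW.
under eq_integral do rewrite EFinM.
rewrite ge0_integralZl_EFin ?powR_ge0//; last exact/measurable_EFinP.
apply: lte_mul_pinfty; rewrite ?lee_fin ?powR_ge0// integral_indic//= setIT.
by rewrite lebesgue_measure_itv/=; case: ifP => _; rewrite -?EFinB ltry.
Qed.

Lemma Lq_upto_ae q tau x y : measurable_fun setT x -> measurable_fun setT y ->
  {ae mu, forall t, t <= tau -> x t = y t} -> Lq_upto q tau x -> Lq_upto q tau y.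
Proof.
move=> mx my xy; rewrite /Lq_upto.
suff -> : (\int[mu]_t (lq_density q tau x t)%:E
    = \int[mu]_t (lq_density q tau y t)%:E)%E by [].
apply: ge0_ae_eq_integral => //.
- by apply/measurable_EFinP; exact: measurable_lq_density.
- by apply/measurable_EFinP; exact: measurable_lq_density.
- by move=> t _; rewrite lee_fin lq_density_ge0.
- by move=> t _; rewrite lee_fin lq_density_ge0.
- apply: ae_imp xy => t xy _; congr (_%:E); rewrite /lq_density.
  by case: ifP => // tt; rewrite xy.
Qed.

End LocalLq.

(** * Causal integrable functions *)

Section CausalFunctions.
Variable R : realType.
Local Notation mu := (@lebesgue_measure R).

Definition causal_pred : {pred (R -> R)} := fun x => `[< causal_integrable x >].

Lemma causal_integrableB (x y : R -> R) : causal_integrable x ->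
  causal_integrable y -> causal_integrable (fun t => x t - y t).
Proof.
move=> [ix x0] [iy y0]; split; first exact: (integrableB measurableT ix iy).
by move=> t t0; rewrite x0// y0// subr0.
Qed.

Lemma causal_integrable_scale c (x : R -> R) :
  causal_integrable x -> causal_integrable (fun t => c * x t).
Proof.
move=> [ix x0]; split; first exact: (integrableZl measurableT c ix).
by move=> t t0; rewrite x0// mulr0.
Qed.

Lemma causal_integrable_delay L (x : R -> R) : 0 <= L ->
  causal_integrable x -> causal_integrable (fun t => x (t - L)).
Proof.
move=> L0 Vx; have mx := causal_integrable_measurable Vx.
move: Vx => [/integrableP[_ xoo] x0]; split; last by move=> t t0; rewrite x0//; lra.
apply/integrableP; split; first by apply/measurable_EFinP; exact: measurable_translate.
rewrite (ge0_integral_translate L (f := fun t => (`|x t|)%:E))//.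
by apply/measurable_EFinP; exact: measurableT_comp.
Qed.

Lemma causal_pred_zmod_closed : zmod_closed causal_pred.
Proof.
split.
  apply/asboolP; split => //.
  by apply: (eq_integrable measurableT (cst 0%E)) => //; exact: integrable0.
by move=> x y /asboolP Vx /asboolP Vy; apply/asboolP; exact: causal_integrableB.
Qed.

HB.instance Definition _ := GRing.isZmodClosed.Build _ causal_pred causal_pred_zmod_closed.

(* Genuine functions rather than classes modulo a.e. equality: the delays and the
   convolutions by bounded kernels commute pointwise. *)
Record causal_fun := CausalFun { causal_val :> R -> R; _ : causal_val \in causal_pred }.
HB.instance Definition _ := [isSub for causal_val].
HB.instance Definition _ := [Choice of causal_fun by <:].
HB.instance Definition _ := [SubChoice_isSubZmodule of causal_fun by <:].

Lemma causal_funP (x : causal_fun) : causal_integrable x.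
Proof. by case: x => x /= /asboolP. Qed.

Lemma measurable_causal_fun (x : causal_fun) : measurable_fun setT x.
Proof. exact: causal_integrable_measurable (causal_funP x). Qed.

Lemma causal_funB (x y : causal_fun) t : (x - y) t = x t - y t.
Proof. by []. Qed.

Lemma causal_funD (x y : causal_fun) t : (x + y) t = x t + y t.
Proof. by []. Qed.

Lemma causal_funN (x : causal_fun) t : (- x) t = - x t.
Proof. by []. Qed.

Lemma causal_fun0 t : (0 : causal_fun) t = 0.
Proof. by []. Qed.

Lemma causal_fun_sum I (r : seq I) (P : pred I) (F : I -> causal_fun) t :
  (\sum_(i <- r | P i) F i) t = \sum_(i <- r | P i) F i t.
Proof. by elim/big_rec2: _ => // i y z _ <-. Qed.

(** The default [0] makes the operations below total; [to_causalE] removes it wherever the function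
    is known to be causal. *)
Definition to_causal (x : R -> R) : causal_fun := insubd 0 x.

Lemma to_causalE x : causal_integrable x -> to_causal x = x :> (R -> R).
Proof. by move=> Vx; rewrite /to_causal val_insubd; case: ifPn => // /asboolP. Qed.

Opaque to_causal.

Lemma causal_fun_inj (x y : causal_fun) : (forall t, x t = y t) -> x = y.
Proof. by move=> xy; apply: val_inj; apply/funext. Qed.

Definition scale_fun c (x : causal_fun) := to_causal (fun t => c * x t).
Definition delay_fun L (x : causal_fun) := to_causal (fun t => x (t - L)).
Definition convol_fun k (x : causal_fun) := to_causal (convol k x).

Lemma scale_funE c x t : scale_fun c x t = c * x t.
Proof. by rewrite to_causalE//; exact/causal_integrable_scale/causal_funP. Qed.

Lemma delay_funE L x t : 0 <= L -> delay_fun L x t = x (t - L).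
Proof.
by move=> L0; rewrite to_causalE//; exact: causal_integrable_delay (causal_funP x).
Qed.

Lemma convol_funE L M k x t : 0 <= L -> bounded_kernel L M k ->
  convol_fun k x t = convol k x t.
Proof.
move=> L0 kk; rewrite to_causalE//.
exact: causal_integrable_convol kk L0 (causal_funP x).
Qed.

Definition zadditive (f : causal_fun -> causal_fun) :=
  forall x y, f (x - y) = f x - f y.

Definition generator (f : causal_fun -> causal_fun) :=
  [\/ exists c, f = scale_fun c,
      exists2 L, 0 <= L & f = delay_fun L
    | exists L M k, [/\ 0 <= L, bounded_kernel L M k & f = convol_fun k]].

Lemma generator_additive f : generator f -> zadditive f.
Proof.
case=> [[c ->]|[L L0 ->]|[L [M [k [L0 kk ->]]]]] x y; apply: causal_fun_inj => t;
  rewrite causal_funB.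
- by rewrite !scale_funE causal_funB mulrBr.
- by rewrite !delay_funE.
- rewrite !(convol_funE _ _ L0 kk); exact: convolB kk (causal_funP x) (causal_funP y).
Qed.

Lemma generator_comm f g : generator f -> generator g -> forall x, f (g x) = g (f x).
Proof.
case=> [[c ->]|[L L0 ->]|[L [M [k [L0 kk ->]]]]];
  case=> [[c' ->]|[L' L'0 ->]|[L' [M' [k' [L'0 kk' ->]]]]] x;
  apply: causal_fun_inj => t.
- by rewrite !scale_funE mulrCA.
- by rewrite !(scale_funE, delay_funE).
- rewrite scale_funE !(convol_funE _ _ L'0 kk').
  rewrite -(convol_scale _ _ kk' (causal_funP x)); congr (convol _ _ t).
  by apply/funext => s; rewrite scale_funE.
- by rewrite !(scale_funE, delay_funE).
- by rewrite !delay_funE//; congr (x _); ring.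
- rewrite delay_funE// !(convol_funE _ _ L'0 kk') -convol_delay.
  by congr (convol _ _ t); apply/funext => s; rewrite delay_funE.
- rewrite scale_funE !(convol_funE _ _ L0 kk).
  rewrite -(convol_scale _ _ kk (causal_funP x)); congr (convol _ _ t).
  by apply/funext => s; rewrite scale_funE.
- rewrite delay_funE// !(convol_funE _ _ L0 kk) -convol_delay.
  by congr (convol _ _ t); apply/funext => s; rewrite delay_funE.
- apply: etrans (convol_funE _ t L0 kk) _.
  apply: etrans _ (esym (convol_funE _ t L'0 kk')).
  rewrite (_ : convol_fun k' x = convol k' x :> (R -> R)); last first.
    by apply/funext => s; exact: convol_funE L'0 kk'.
  rewrite (_ : convol_fun k x = convol k x :> (R -> R)); last first.
    by apply/funext => s; exact: convol_funE L0 kk.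
  exact: convolC kk kk' L0 L'0 (causal_funP x).
Qed.

Lemma zadditive0 f : zadditive f -> f 0 = 0.
Proof. by move=> fB; have := fB 0 0; rewrite !subrr. Qed.

Lemma zadditiveN f x : zadditive f -> f (- x) = - f x.
Proof. by move=> fB; rewrite -sub0r fB zadditive0// sub0r. Qed.

Lemma zadditiveD f x y : zadditive f -> f (x + y) = f x + f y.
Proof. by move=> fB; have := fB x (- y); rewrite (zadditiveN y fB) !opprK. Qed.

Lemma wnormB lam tau (x y : causal_fun) :
  (wnorm lam tau (x - y)%R <= wnorm lam tau x + wnorm lam tau y)%E.
Proof.
have -> : wnorm lam tau y = wnorm lam tau (fun t => - y t).
  by apply: eq_integral => t _; rewrite /weight normrN.
apply: wnorm_triangle; first exact: measurable_causal_fun.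
by apply: measurableT_comp => //; exact: measurable_causal_fun.
Qed.

Lemma Lq_uptoB q tau (x y : causal_fun) : 0 <= q ->
  Lq_upto q tau x -> Lq_upto q tau y -> Lq_upto q tau (x - y).
Proof.
move=> q0 Lx Ly; have mx := measurable_causal_fun x; have my := measurable_causal_fun y.
have mNy : measurable_fun setT (fun t : R => -1 * y t) by exact: measurable_funM.
have := Lq_uptoD q0 mx mNy Lx
  (Lq_upto_scale (-1) my Ly).
rewrite (_ : (fun t => _) = (x - y : causal_fun))//; apply/funext => t.
by rewrite /= mulN1r.
Qed.

End CausalFunctions.

(** * The commutative ring of causal operators *)

Section OperatorRing.
Variables (R : realType) (q : R).
Local Notation V := (causal_fun R).
Implicit Types (f g h : V -> V) (lam tau eps : R) (x y : V).

(** Membership in the bicommutant of the generators. This condition passes to differences and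
    compositions at once, and any two additive maps satisfying it commute; no normal form for
    polynomials in the generators is involved. *)
Definition bicommutes f := forall h, zadditive h ->
  (forall s, generator s -> forall x, h (s x) = s (h x)) ->
  forall x, f (h x) = h (f x).

(** One constant for all [tau] encodes causality: an input that is zero almost everywhere up to
    [tau] has such an output. *)
Definition wbounded f := exists2 C : R, 0 <= C &
  forall lam tau x, 0 <= lam ->
    (wnorm lam tau (f x) <= C%:E * wnorm lam tau x)%E.

(** The premise [0 < q] sits inside the definition so that the type of operators, and its ring
    structure, exist for every [q]. *)
Definition preserves_Lq f := 0 < q ->
  forall tau x, Lq_upto q tau x -> Lq_upto q tau (f x).

Definition admissible f :=
  [/\ zadditive f, bicommutes f, wbounded f & preserves_Lq f].

Definition admissible_pred : {pred (V -> V)} := fun f => `[< admissible f >].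

Lemma wboundedB f g : wbounded f -> wbounded g -> wbounded (fun x => f x - g x).
Proof.
move=> [C C0 fC] [D D0 gD]; exists (C + D); first exact: addr_ge0.
move=> lam tau x lam0; apply: le_trans (wnormB _ _ _ _) _.
rewrite EFinD ge0_muleDl ?lee_fin//.
by apply: leeD; [exact: fC|exact: gD].
Qed.

Lemma wbounded_comp f g : wbounded f -> wbounded g -> wbounded (f \o g).
Proof.
move=> [C C0 fC] [D D0 gD]; exists (C * D); first exact: mulr_ge0.
move=> lam tau x lam0; apply: le_trans (fC _ _ _ lam0) _.
by rewrite EFinM -muleA lee_wpmul2l ?lee_fin//; exact: gD.
Qed.

Lemma admissible0 : admissible (fun=> 0).
Proof.
split.
- by move=> x y; rewrite subrr.
- by move=> h hB _ x; rewrite (zadditive0 hB).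
- exists 0 => // lam tau x lam0; rewrite mul0e.
  rewrite (_ : wnorm _ _ _ = 0%E)//; apply: integral0_eq => t _.
  by rewrite /weight; case: ifP => // _; rewrite causal_fun0 normr0 mulr0.
- move=> q0 tau x _; apply: (@Lq_upto_bounded R q tau 0) => //.
    exact: measurable_causal_fun.
  by move=> t; rewrite /= normr0.
Qed.

Lemma admissibleB f g : admissible f -> admissible g -> admissible (fun x => f x - g x).
Proof.
move=> [fB fc fw fq] [gB gc gw gq]; split.
- by move=> x y; rewrite fB gB !opprD !opprK addrACA.
- by move=> h hB hs x; rewrite fc// gc// hB.
- exact: wboundedB.
- by move=> q0 tau x Lx; apply: Lq_uptoB; [exact: ltW|exact: fq|exact: gq].
Qed.

Lemma admissible_comp f g : admissible f -> admissible g -> admissible (f \o g).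
Proof.
move=> [fB fc fw fq] [gB gc gw gq]; split.
- by move=> x y; rewrite /= gB fB.
- by move=> h hB hs x; rewrite /= gc// fc.
- exact: wbounded_comp.
- by move=> q0 tau x Lx; apply: fq => //; exact: gq.
Qed.

Lemma admissible_id : admissible id.
Proof. by split => //; exists 1 => // lam tau x _; rewrite mul1e. Qed.

Lemma admissible_zmod_closed : zmod_closed admissible_pred.
Proof.
split; first exact/asboolP/admissible0.
by move=> f g /asboolP fa /asboolP ga; apply/asboolP; exact: admissibleB.
Qed.

HB.instance Definition _ :=
  GRing.isZmodClosed.Build _ admissible_pred admissible_zmod_closed.

Record operator := Operator { op_val :> V -> V; _ : op_val \in admissible_pred }.
HB.instance Definition _ := [isSub for op_val].
HB.instance Definition _ := [Choice of operator by <:].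
HB.instance Definition _ := [SubChoice_isSubZmodule of operator by <:].

Lemma operatorP (f : operator) : admissible f.
Proof. by case: f => f /= /asboolP. Qed.

Definition op_one : operator := Operator (introT (asboolP _) admissible_id).
Definition op_mul (f g : operator) : operator :=
  Operator (introT (asboolP _) (admissible_comp (operatorP f) (operatorP g))).

Lemma operator_inj (f g : operator) : (forall x, f x = g x) -> f = g.
Proof. by move=> fg; apply: val_inj; apply/funext. Qed.

Lemma op_mulA : associative op_mul.
Proof. by move=> f g h; exact: operator_inj. Qed.

(* [g] commutes with the generators because these commute with each other,
   and therefore with [f]. *)
Lemma op_mulC : commutative op_mul.
Proof.
move=> f g; apply: operator_inj => x /=.
have [_ fc _ _] := operatorP f; have [gB gc _ _] := operatorP g.
apply: fc => // s gs y; apply: gc; first exact: generator_additive.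
by move=> s' gs' z; exact: (generator_comm gs gs' z).
Qed.

Lemma op_mul1 : left_id op_one op_mul.
Proof. by move=> f; exact: operator_inj. Qed.

Lemma op_mulDl : left_distributive op_mul +%R.
Proof. by move=> f g h; exact: operator_inj. Qed.

HB.instance Definition _ := GRing.Zmodule_isComPzRing.Build operator
  op_mulA op_mulC op_mul1 op_mulDl.

Lemma operatorM (f g : operator) x : (f * g) x = f (g x). Proof. by []. Qed.
Lemma operator1 x : (1 : operator) x = x. Proof. by []. Qed.
Lemma operatorD (f g : operator) x : (f + g) x = f x + g x. Proof. by []. Qed.
Lemma operatorB (f g : operator) x : (f - g) x = f x - g x. Proof. by []. Qed.
Lemma operator0 x : (0 : operator) x = 0. Proof. by []. Qed.

Lemma operator_sum I (r : seq I) (P : pred I) (F : I -> operator) x :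
  (\sum_(i <- r | P i) F i) x = \sum_(i <- r | P i) F i x.
Proof. by elim/big_rec2: _ => // i y z _ <-. Qed.

Lemma operator_additive (f : operator) : zadditive f.
Proof. by have [] := operatorP f. Qed.

Lemma operator_lin0 (f : operator) : f 0 = 0.
Proof. exact/zadditive0/operator_additive. Qed.

Lemma operator_linB (f : operator) x y : f (x - y) = f x - f y.
Proof. exact: operator_additive. Qed.

Lemma operator_linD (f : operator) x y : f (x + y) = f x + f y.
Proof. exact/zadditiveD/operator_additive. Qed.

Lemma operator_lin_sum (f : operator) I (r : seq I) (P : pred I) (F : I -> V) :
  f (\sum_(i <- r | P i) F i) = \sum_(i <- r | P i) f (F i).
Proof.
by elim/big_rec2: _ => [|i y z _ <-]; [exact: operator_lin0|exact: operator_linD].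
Qed.

Lemma generator_bicommutes f : generator f -> bicommutes f.
Proof. by move=> gf h hB hs x; rewrite hs. Qed.

(** The default is the zero operator; the equations below show that it is not taken for scalings,
    nonnegative delays and bounded kernels. *)
Definition scale_op c : operator := insubd 0 (@scale_fun R c).
Definition delay_op L : operator := insubd 0 (@delay_fun R L).
Definition convol_op k : operator := insubd 0 (@convol_fun R k).

Lemma scale_opE c x : scale_op c x = scale_fun c x.
Proof.
rewrite /scale_op val_insubd ifT//; apply/asboolP.
have gf : generator (@scale_fun R c) by apply: Or31; exists c.
split.
- exact: generator_additive.
- exact: generator_bicommutes.
- exists `|c| => // lam tau y _.
  rewrite (_ : scale_fun c y = (fun t => c * y t) :> (R -> R)).
    by rewrite wnorm_scale//; exact: measurable_causal_fun.
  by apply/funext => t; rewrite scale_funE.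
- move=> _ tau y Ly.
  rewrite (_ : scale_fun c y = (fun t => c * y t) :> (R -> R)).
    by apply: Lq_upto_scale => //; exact: measurable_causal_fun.
  by apply/funext => t; rewrite scale_funE.
Qed.

Lemma wnorm_delay_fun lam tau L x : 0 <= L ->
  (wnorm lam tau (delay_fun L x) <= (expR (- (lam * L)))%:E * wnorm lam tau x)%E.
Proof.
move=> L0; rewrite (_ : delay_fun L x = (fun t => x (t - L)) :> (R -> R)).
  by apply: wnorm_delay => //; exact: measurable_causal_fun.
by apply/funext => t; rewrite delay_funE.
Qed.

Lemma Lq_upto_delay_fun tau L x : 0 <= L ->
  Lq_upto q tau x -> Lq_upto q (tau + L) (delay_fun L x).
Proof.
move=> L0 Lx; rewrite (_ : delay_fun L x = (fun t => x (t - L)) :> (R -> R)).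
  by apply: Lq_upto_delay => //; exact: measurable_causal_fun.
by apply/funext => t; rewrite delay_funE.
Qed.

Lemma delay_opE L x : 0 <= L -> delay_op L x = delay_fun L x.
Proof.
move=> L0; rewrite /delay_op val_insubd ifT//; apply/asboolP.
have gf : generator (@delay_fun R L) by apply: Or32; exists L.
split.
- exact: generator_additive.
- exact: generator_bicommutes.
- exists 1 => // lam tau y lam0; apply: le_trans (wnorm_delay_fun _ _ _ L0) _.
  rewrite lee_wpmul2r ?wnorm_ge0// lee_fin -expR0 ler_expR oppr_le0.
  exact: mulr_ge0.
- move=> _ tau y Ly; apply: (Lq_upto_le (tau := tau + L)).
  + exact: measurable_causal_fun.
  + by lra.
  + exact: Lq_upto_delay_fun.
Qed.

Lemma wnorm_convol_fun lam tau L M k x : 0 <= L -> bounded_kernel L M k ->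
  (wnorm lam tau (convol_fun k x) <= kernel_mass lam k * wnorm lam tau x)%E.
Proof.
move=> L0 kk; rewrite (_ : convol_fun k x = convol k x :> (R -> R)).
  exact: wnorm_convol kk L0 (causal_funP x).
by apply/funext => t; exact: convol_funE L0 kk.
Qed.

Lemma Lq_upto_convol_fun tau L M k x : 0 < q -> 0 <= L -> bounded_kernel L M k ->
  Lq_upto q tau (convol_fun k x).
Proof.
move=> q0 L0 kk; have [ix _] := causal_funP x.
apply: (Lq_upto_bounded _ q0 (measurable_causal_fun _)) => t.
  rewrite (convol_funE _ _ L0 kk); exact: norm_convol_le kk ix.
by have [_] := causal_funP (convol_fun k x); exact.
Qed.

Lemma convol_opE L M k x : 0 <= L -> bounded_kernel L M k ->
  convol_op k x = convol_fun k x.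
Proof.
move=> L0 kk; rewrite /convol_op val_insubd ifT//; apply/asboolP.
have gf : generator (@convol_fun R k) by apply: Or33; exists L, M, k.
have [mk kM _] := kk; have M0 : 0 <= M := le_trans (normr_ge0 _) (kM 0).
split.
- exact: generator_additive.
- exact: generator_bicommutes.
- exists (M * L); first exact: mulr_ge0.
  move=> lam tau y lam0; apply: le_trans (wnorm_convol_fun _ _ _ L0 kk) _.
  rewrite lee_wpmul2r ?wnorm_ge0//.
  have := kernel_mass_le kk L0 lam0 (lexx 0).
  by rewrite mulr0 oppr0 expR0 mul1r add0r.
- by move=> q0 tau y _; exact: Lq_upto_convol_fun q0 L0 kk.
Qed.

End OperatorRing.

(** * An ideal of quasi-nilpotent operators *)

Section Radical.
Variables (R : realType) (q eta : R).
Local Notation V := (causal_fun R).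
Local Notation op := (operator q).
Implicit Types (f g : op) (lam tau eps : R) (x y : V).

Definition contracting f := forall eps, 0 < eps -> exists2 l0 : R, 0 <= l0 &
  forall lam tau x, l0 <= lam ->
    (wnorm lam tau (f x) <= eps%:E * wnorm lam tau x)%E.

(** Integrability of the input up to [tau] yields that of the output [eta] further, as for a delay
    of at least [eta]. A convolution satisfies this for any [eta]. *)
Definition smoothing f := 0 < q ->
  forall tau x, Lq_upto q tau x -> Lq_upto q (tau + eta) (f x).

(* For [f] in this ideal [1 - f] is invertible on bounded time intervals:
   [contracting] makes its Neumann series converge, and [smoothing] keeps the sum
   locally in L^q. *)
Definition radical f := contracting f /\ smoothing f.

Lemma radical0 : radical 0.
Proof.
split.
  move=> eps e0; exists 0 => // lam tau x _; rewrite operator0.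
  rewrite (_ : wnorm _ _ _ = 0%E) ?mule_ge0 ?wnorm_ge0 ?lee_fin ?(ltW e0)//.
  apply: integral0_eq => t _.
  by rewrite /weight; case: ifP => // _; rewrite causal_fun0 normr0 mulr0.
move=> q0 tau x _; rewrite operator0.
have [_ _ _] := admissible0 q; move=> /(_ q0 (tau + eta) 0); apply.
by apply: (@Lq_upto_bounded R q _ 0) => //;
  [exact: measurable_causal_fun|move=> t; rewrite /= normr0].
Qed.

Lemma radicalB f g : radical f -> radical g -> radical (f - g).
Proof.
move=> [fc fs] [gc gs]; split.
  move=> eps e0; have e20 : 0 < eps / 2 by rewrite divr_gt0.
  have [l1 l10 f1] := fc _ e20; have [l2 l20 g2] := gc _ e20.
  exists (l1 + l2) => [|lam tau x ll]; first exact: addr_ge0.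
  rewrite operatorB; apply: le_trans (wnormB _ _ _ _) _.
  rewrite [eps]splitr EFinD ge0_muleDl ?lee_fin ?(ltW e20)//.
  by apply: leeD; [apply: f1|apply: g2]; apply: le_trans ll; rewrite ?lerDl ?lerDr.
move=> q0 tau x Lx; rewrite operatorB.
by apply: Lq_uptoB; [exact: ltW|exact: fs|exact: gs].
Qed.

Lemma radicalN f : radical f -> radical (- f).
Proof. by move=> rf; rewrite -sub0r; exact: (radicalB radical0 rf). Qed.

Lemma radicalD f g : radical f -> radical g -> radical (f + g).
Proof. by move=> rf rg; rewrite -[g]opprK; exact: (radicalB rf (radicalN rg)). Qed.

Lemma radical_sum I (r : seq I) (P : pred I) (F : I -> op) :
  (forall i, P i -> radical (F i)) -> radical (\sum_(i <- r | P i) F i).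
Proof. by move=> rF; apply: big_ind rF; [exact: radical0|exact: radicalD]. Qed.

Lemma radicalMl f g : radical f -> radical (g * f).
Proof.
move=> [fc fs]; have [_ _ [C C0 gC] gq] := operatorP g; split.
  (* Dividing by [C + 1] covers the case [C = 0]. *)
  move=> eps e0; have C1 : 0 < C + 1 by rewrite ltr_wpDl.
  have [l0 l00 fl] := fc _ (divr_gt0 e0 C1).
  exists l0 => // lam tau x ll; rewrite operatorM.
  apply: le_trans (gC _ _ _ (le_trans l00 ll)) _.
  apply: (@le_trans _ _ (C%:E * ((eps / (C + 1))%:E * wnorm lam tau x))%E).
    by rewrite lee_wpmul2l ?lee_fin//; exact: fl.
  rewrite muleA -EFinM lee_wpmul2r ?wnorm_ge0// lee_fin mulrCA ler_piMr ?(ltW e0)//.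
  by rewrite ler_pdivrMr// mul1r lerDl.
by move=> q0 tau x Lx; rewrite operatorM; apply: gq => //; exact: fs.
Qed.

Lemma expRN_le eps (y : R) : 0 < eps -> eps^-1 <= y -> expR (- y) <= eps.
Proof.
move=> e0 ey; rewrite expRN -[leRHS]invrK lef_pV2 ?posrE ?expR_gt0 ?invr_gt0//.
by apply: le_trans ey _; apply: le_trans (expR_ge1Dx y); rewrite lerDr.
Qed.

Lemma radical_delay L : 0 < L -> eta <= L -> radical (delay_op q L).
Proof.
move=> L0 eL; split.
  move=> eps e0; exists (eps^-1 / L); first by rewrite divr_ge0 ?invr_ge0// ltW.
  move=> lam tau x ll; rewrite (delay_opE _ _ (ltW L0)).
  apply: le_trans (wnorm_delay_fun _ _ _ (ltW L0)) _.
  rewrite lee_wpmul2r ?wnorm_ge0// lee_fin expRN_le//.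
  by rewrite -ler_pdivrMr.
move=> q0 tau x Lx; rewrite (delay_opE _ _ (ltW L0)).
apply: (Lq_upto_le (tau := tau + L)); rewrite ?lerD2l//.
  exact: measurable_causal_fun.
exact: Lq_upto_delay_fun (ltW L0) Lx.
Qed.

Lemma radical_convol L M k : 0 <= L -> bounded_kernel L M k ->
  radical (convol_op q k).
Proof.
move=> L0 kk; have [mk kM _] := kk.
have M0 : 0 <= M := le_trans (normr_ge0 _) (kM 0).
split; last first.
  move=> q0 tau x _; rewrite (convol_opE _ _ L0 kk).
  exact: Lq_upto_convol_fun q0 L0 kk.
move=> eps e0; have M1 : 0 < M + 1 by rewrite ltr_wpDl.
have L1 : 0 < L + 1 by rewrite ltr_wpDl.
(* [e1] plays the role of [delta] in [kernel_mass_le]. Once lam e1 is at least the inverse of [e2],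
   the exponential is at most [e2], so its product with [L] is at most [e1], and the total is at
   most (M + 1)(e1 + e1) = eps. *)
pose e1 := eps / (2 * (M + 1)); have e10 : 0 < e1 by rewrite divr_gt0// mulr_gt0.
pose e2 := e1 / (L + 1); have e20 : 0 < e2 by rewrite divr_gt0.
exists (e2^-1 / e1); first by rewrite divr_ge0 ?invr_ge0// ltW.
move=> lam tau x ll; rewrite (convol_opE _ _ L0 kk).
apply: le_trans (wnorm_convol_fun _ _ _ L0 kk) _.
rewrite lee_wpmul2r ?wnorm_ge0//.
have lam0 : 0 <= lam by apply: le_trans ll; rewrite divr_ge0 ?invr_ge0// ltW.
apply: le_trans (kernel_mass_le kk L0 lam0 (ltW e10)) _; rewrite lee_fin.
have ex : expR (- (lam * e1)) <= e2 by rewrite expRN_le// -ler_pdivrMr.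
have eL : expR (- (lam * e1)) * L <= e1.
  apply: (@le_trans _ _ (e2 * (L + 1))); last by rewrite /e2 divfK// gt_eqF.
  by rewrite ler_pM ?expR_ge0// lerDl.
apply: (@le_trans _ _ ((M + 1) * (e1 + e1))).
  by rewrite ler_pM// ?lerDl// ?lerD2l// addr_ge0 ?(ltW e10)// mulr_ge0// expR_ge0.
by rewrite /e1 le_eqVlt; apply/orP; left; apply/eqP; field; rewrite gt_eqF.
Qed.

(* Every Leibniz term of [\det (1 - M)] agrees modulo the ideal with that of [\det 1]. *)
Lemma radical_det n (M : 'M[op]_n) : (forall i j, radical (M i j)) ->
  radical (1 - \det (1%:M - M)).
Proof.
move=> rM; rewrite -[X in X - _](@det1 _ n) /determinant -opprB; apply: radicalN.
apply: (big_ind2 (fun f g : op => radical (f - g))).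
- by rewrite subrr; exact: radical0.
- by move=> f1 f2 g1 g2 rf rg; rewrite opprD addrACA; exact: (radicalD rf rg).
move=> s _; rewrite -mulrBr; apply: radicalMl.
apply: (big_ind2 (fun f g : op => radical (f - g))).
- by rewrite subrr; exact: radical0.
- move=> f1 f2 g1 g2 rf rg.
  rewrite (_ : f1 * g1 - f2 * g2 = g1 * (f1 - f2) + f2 * (g1 - g2)).
    exact: (radicalD (radicalMl _ rf) (radicalMl _ rg)).
  by rewrite !mulrBr addrA [g1 * f1]mulrC [g1 * f2]mulrC subrK.
- move=> i _; rewrite !mxE addrAC subrr sub0r; apply: radicalN; exact: rM.
Qed.

(** The end of the support moves by at most n L. Counting in multiples of [L] makes [n] behave like
    a degree: it adds up under products and is kept by sums. *)
Definition spread L n f := forall tau x, (forall t, tau < t -> x t = 0) ->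
  forall t, tau + n%:R * L < t -> f x t = 0.

Lemma spread_le L m n f : 0 <= L -> (m <= n)%N -> spread L m f -> spread L n f.
Proof.
move=> L0 mn sf tau x x0 t tt; apply: (sf tau) => //; apply: le_lt_trans tt.
by rewrite lerD2l ler_wpM2r// ler_nat.
Qed.

Lemma spread1 L : spread L 0 1.
Proof. by move=> tau x x0 t; rewrite mul0r addr0; exact: x0. Qed.

Lemma spread0 L n : spread L n 0.
Proof. by []. Qed.

Lemma spreadD L n f g : spread L n f -> spread L n g -> spread L n (f + g).
Proof.
move=> sf sg tau x x0 t tt; rewrite operatorD causal_funD (sf tau)// (sg tau)//.
by rewrite addr0.
Qed.

Lemma spreadN L n f : spread L n f -> spread L n (- f).
Proof.
by move=> sf tau x x0 t tt; rewrite -sub0r operatorB causal_funB (sf tau)// subr0.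
Qed.

Lemma spreadM L m n f g : spread L m f -> spread L n g -> spread L (m + n) (f * g).
Proof.
move=> sf sg tau x x0 t; rewrite natrD mulrDl addrA addrAC => tt.
by rewrite operatorM; apply: (sf (tau + n%:R * L)) => //; exact: sg.
Qed.

Lemma spread_sign L b : spread L 0 ((-1) ^+ b).
Proof.
elim: b => [|b IH]; first exact: spread1.
by rewrite exprS -[0%N]addn0; apply: spreadM => //; apply: spreadN; exact: spread1.
Qed.

(** Each Leibniz term is a signed product of [n] entries, and spreads add under products. *)
Lemma spread_det L n (M : 'M[op]_n) : (forall i j, spread L 1 (M i j)) ->
  spread L n (\det M).
Proof.
move=> sM; apply: (big_ind (spread L n)) => [||s _]; first exact: spread0.
  by move=> f g; exact: spreadD.
rewrite -[n in spread L n]add0n; apply: spreadM; first exact: spread_sign.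
rewrite -[n in spread L n]card_ord -sum1_card.
apply: (big_ind2 (spread L)) => //; first exact: spread1.
by move=> f1 f2 g1 g2; exact: spreadM.
Qed.

(** A cofactor is a signed minor of size [n.-1]. The bound is rounded up to [n], for which a horizon
    above (d + 1) Lam N leaves room. *)
Lemma spread_adj L n (M : 'M[op]_n) i j : 0 <= L ->
  (forall i j, spread L 1 (M i j)) -> spread L n ((\adj M) i j).
Proof.
move=> L0 sM; rewrite mxE; apply: (@spread_le _ (0 + n.-1)) => //.
  by rewrite add0n leq_pred.
apply: spreadM; first exact: spread_sign.
by apply: spread_det => i' j'; rewrite !mxE.
Qed.

Lemma spread_scale L c : spread L 0 (scale_op q c).
Proof.
move=> tau x x0 t; rewrite mul0r addr0 => tt.
by rewrite scale_opE scale_funE x0// mulr0.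
Qed.

Lemma spread_delay L a : 0 <= a -> a <= L -> spread L 1 (delay_op q a).
Proof.
move=> a0 aL tau x x0 t; rewrite mul1r => tt.
by rewrite delay_opE// delay_funE// x0//; lra.
Qed.

Lemma spread_convol L M k : 0 <= L -> bounded_kernel L M k ->
  spread L 1 (convol_op q k).
Proof.
move=> L0 kk tau x x0 t; rewrite mul1r => tt.
by rewrite (convol_opE _ _ L0 kk) (convol_funE _ _ L0 kk) (convol_eq0_after kk x0).
Qed.

Lemma operator_ae_causal f tau x :
  {ae lebesgue_measure, forall t, t <= tau -> x t = 0} ->
  {ae lebesgue_measure, forall t, t <= tau -> f x t = 0}.
Proof.
move=> /(wnorm_eq0P 0 _ (measurable_causal_fun x)) wx.
apply/(wnorm_eq0P 0 _ (measurable_causal_fun (f x))).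
have [_ _ [C C0 fC] _] := operatorP f.
apply/eqP; rewrite eq_le wnorm_ge0 andbT.
by have := fC 0 tau x (lexx 0); rewrite wx mule0.
Qed.

(** For a suitable weight the norm of f x is at most half that of x. If x = f x up to [tau], the
    norm of x is at most half of itself, and it is finite, hence zero. *)
Lemma radical_unique f tau x : radical f ->
  {ae lebesgue_measure, forall t, t <= tau -> (1 - f) x t = 0} ->
  {ae lebesgue_measure, forall t, t <= tau -> x t = 0}.
Proof.
move=> [fc _] fx0; have [l0 l00 fl] := fc (1 / 2) ltac:(by rewrite divr_gt0).
have fle := fl l0 tau x (lexx _).
move/(wnorm_eq0P l0 _ (measurable_causal_fun ((1 - f) x))): fx0 => w0.
apply/(wnorm_eq0P l0 _ (measurable_causal_fun x)).
move: fle; have := wnormB l0 tau ((1 - f) x) (- f x).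
have -> : wnorm l0 tau (- f x)%R = wnorm l0 tau (f x).
  by apply: eq_integral => t _; rewrite /weight causal_funN normrN.
rewrite w0 add0e operatorB operator1 opprK subrK.
have := wnorm_fin_num tau (causal_funP x) l00.
have := wnorm_fin_num tau (causal_funP (f x)) l00.
have := wnorm_ge0 l0 tau x.
case: (wnorm l0 tau x) => // a; case: (wnorm l0 tau (f x)) => // b.
rewrite -EFinM !lee_fin => a0 _ _ ba ab; congr (_%:E); lra.
Qed.

End Radical.

(** * Neumann series *)

Section Neumann.
Variables (R : realType).
Local Notation mu := (@lebesgue_measure R).
Local Notation V := (causal_fun R).
Implicit Types (lam tau eps : R) (x y : V).

Lemma halves_sum_le (K : R) (a : nat -> \bar R) : 0 <= K ->
  (forall n, 0 <= a n)%E -> (forall n, a n <= (K / 2 ^+ n)%:E)%E ->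
  (\sum_(0 <= n <oo) a n <= (2 * K)%:E)%E.
Proof.
move=> K0 a0 aK; apply: lime_le; first by apply: is_cvg_nneseries => n _ _; exact: a0.
apply: nearW => n.
apply: (@le_trans _ _ (\sum_(0 <= i < n) (K / 2 ^+ i)%:E)%E).
  by apply: lee_sum => i _; exact: aK.
rewrite sumEFin lee_fin.
suff -> : \sum_(0 <= i < n) K / 2 ^+ i = 2 * K - 2 * (K / 2 ^+ n).
  by rewrite gerBl mulr_ge0// divr_ge0// exprn_ge0.
elim: n => [|n IH]; first by rewrite big_geq// expr0 divr1 subrr.
rewrite big_nat_recr//= IH exprS; field.
by rewrite expf_neq0.
Qed.

(** Completeness of L^1 up to [tau], for series dominated by a geometric one. The sum of absolute
    values is integrable and dominates the partial sums, so dominated convergence applies; the limit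
    is a genuine function, zero at negative times and after [tau]. *)
Lemma causal_complete tau (v : nat -> V) (K : R) : 0 <= K ->
  (forall n, wnorm 0 tau (v n) <= (K / 2 ^+ n)%:E)%E ->
  exists2 z : V, (forall t, tau < t -> z t = 0) &
  forall eps, 0 < eps -> \forall n \near \oo,
    (wnorm 0 tau (z - \sum_(0 <= k < n) v k)%R <= eps%:E)%E.
Proof.
move=> K0 vK; pose u t n := if t <= tau then v n t else 0.
have uE n t : `|u t n| = weight 0 tau (v n) t.
  by rewrite /u /weight; case: ifP => _; rewrite ?normr0// mul0r oppr0 expR0 mul1r.
have mv n : measurable_fun setT (v n) by exact: measurable_causal_fun.
have mu_ n : measurable_fun setT (u^~ n).
  by apply: measurable_fun_ifT => //; exact: measurable_fun_ler.
have mun n : measurable_fun setT (fun t : R => (`|u t n|)%:E).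
  by apply/measurable_EFinP; apply: (measurableT_comp (@normr_measurable R setT)); exact: mu_.
pose S t : \bar R := (\sum_(0 <= n <oo) (`|u t n|)%:E)%E.
have S0 t : (0 <= S t)%E by apply: nneseries_ge0 => n _ _; rewrite lee_fin.
have mS : measurable_fun setT S.
  by apply: ge0_emeasurable_sum => [n t _ _|n _]; [rewrite lee_fin|exact: mun].
have iS : mu.-integrable setT S.
  apply/integrableP; split => //.
  under eq_integral do rewrite gee0_abs//.
  rewrite integral_nneseries//.
  apply: (le_lt_trans (halves_sum_le K0 _ _)) (ltry _) => n.
    by apply: integral_ge0 => t _; rewrite lee_fin.
  by under eq_integral do rewrite uE; exact: vK.
(* Partial sums are replaced by 0 on the null set where [S] is infinite, so that [h] converges at
   every point and its limit is measurable. *)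
pose h n t := if S t \is a fin_num then \sum_(0 <= k < n) u t k else 0.
have mfin : measurable_fun setT (fun t => S t \is a fin_num).
  apply: (measurable_fun_bool true); rewrite setTI.
  by have := emeasurable_fin_num measurableT mS; rewrite setTI.
have mh n : measurable_fun setT (h n).
  apply: measurable_fun_ifT => //.
  rewrite (_ : (fun t => _) = (fun t => \sum_(k <- index_iota 0 n) u t k))//.
  by apply: measurable_sum => k; exact: mu_.
have leS n t : ((\sum_(0 <= k < n) `|u t k|)%:E <= S t)%E.
  rewrite -sumEFin; apply: nneseries_lim_ge => k _; by rewrite lee_fin.
have hcvg t : cvgn (h ^~ t).
  have [Sf|Sf] := boolP (S t \is a fin_num); last first.
    rewrite (_ : h ^~ t = cst 0); first exact: is_cvg_cst.
    by apply/funext => n; rewrite /h (negbTE Sf).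
  rewrite (_ : h ^~ t = series (u t)); last by apply/funext => n; rewrite /h Sf.
  apply: (@normed_cvg _ R^o).
  rewrite (_ : [normed series (u t)] = (fun n => \sum_(0 <= k < n) `|u t k|)); last by [].
  apply: nondecreasing_is_cvgn.
    by apply: (@nondecreasing_series _ _ xpredT) => k _ _; exact: normr_ge0.
  by exists (fine (S t)) => _ [n _ <-]; rewrite -lee_fin fineK//; exact: leS.
pose z0 t := limn (h ^~ t).
have hz t : h ^~ t @ \oo --> z0 t by exact: hcvg.
have mz0 : measurable_fun setT z0.
  by apply: (measurable_fun_cvg (h := h)) => // t _; exact: hz.
have hS n t : (`|(h n t)%:E| <= S t)%E.
  rewrite /h; case: ifPn => [Sf|_]; last by rewrite abse0.
  by apply: le_trans (leS n t); rewrite lee_fin ler_norm_sum.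
have ehz t : (fun n => (h n t)%:E) @ \oo --> (z0 t)%:E.
  by apply/fine_cvgP; split; [exact: nearW|exact: hz].
have meh n : measurable_fun setT (fun t : R => (h n t)%:E) by exact/measurable_EFinP.
have mez : measurable_fun setT (fun t : R => (z0 t)%:E) by exact/measurable_EFinP.
have [iz0 hz0 _] := @dominated_convergence _ _ _ mu setT measurableT
  (fun n t => (h n t)%:E) (fun t => (z0 t)%:E) S meh mez
  (aeW mu (fun t _ => ehz t)) iS (aeW mu (fun t n _ => hS n t)).
have z00 t : (forall n, u t n = 0) -> z0 t = 0.
  move=> u0; rewrite /z0 (_ : h ^~ t = cst 0) ?lim_cst//.
  by apply/funext => n; rewrite /h big1 ?if_same.
have Vz : causal_integrable z0.
  split => // t t0; apply: z00 => n; rewrite /u; case: ifP => // _.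
  by have [_] := causal_funP (v n); exact.
exists (to_causal z0).
  by move=> t tt; rewrite to_causalE//; apply: z00 => n; rewrite /u leNgt tt.
move=> eps e0.
have wE n : wnorm 0 tau (to_causal z0 - \sum_(0 <= k < n) v k)%R
    = (\int[mu]_t `|(h n t)%:E - (z0 t)%:E|)%E.
  apply: ge0_ae_eq_integral => //.
  - by apply: measurable_EFin_weight; exact: measurable_causal_fun.
  - apply: measurableT_comp => //.
    exact: (emeasurable_funB (meh n) mez).
  - by move=> t _; rewrite lee_fin weight_ge0.
  have := integrable_ae measurableT iS; apply: ae_imp => t /(_ I) Sf _.
  rewrite -EFinB abse_EFin; congr (_%:E).
  rewrite /weight causal_funB causal_fun_sum to_causalE// /h Sf.
  case: ifPn => tt.
    rewrite mul0r oppr0 expR0 mul1r distrC; congr (`|_ - _|).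
    by apply: eq_bigr => k _; rewrite /u tt.
  rewrite z00 ?big1 ?subrr ?normr0// => [k _|k]; by rewrite /u (negbTE tt).
have /fine_cvgP[_] := hz0; move=> /cvgrPdist_le /(_ eps e0).
have fin n : (\int[mu]_t `|(h n t)%:E - (z0 t)%:E|)%E \is a fin_num.
  by rewrite -wE wnorm_fin_num//; exact: causal_funP.
apply: filterS => n /=; rewrite sub0r normrN => hn.
rewrite wE -[leLHS]fineK// lee_fin; exact: le_trans (ler_norm _) hn.
Qed.

End Neumann.

(** * Solving (1 - a) z = u on a bounded time interval, and local L^q integrability of z *)

Section NeumannSolution.
Variables (R : realType) (q eta : R).
Local Notation mu := (@lebesgue_measure R).
Local Notation V := (causal_fun R).
Local Notation op := (operator q).
Implicit Types (f a : op) (lam tau eps : R) (x y u z : V).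

Lemma contracting_expr a tau lam u n :
  (forall x, wnorm lam tau (a x) <= (1 / 2)%:E * wnorm lam tau x)%E ->
  (wnorm lam tau ((a ^+ n)%R u) <= (1 / 2 ^+ n)%:E * wnorm lam tau u)%E.
Proof.
move=> aw; elim: n => [|n IH]; first by rewrite expr0 operator1 expr0 divr1 mul1e.
rewrite exprS operatorM; apply: le_trans (aw _) _.
rewrite (_ : 1 / 2 ^+ n.+1 = (1 / 2) * (1 / 2 ^+ n) :> R); last first.
  by rewrite exprS; field; rewrite expf_neq0.
by rewrite (EFinM (1 / 2) (1 / 2 ^+ n)) -muleA lee_wpmul2l// lee_fin.
Qed.

Lemma neumann_partial a u n :
  (1 - a) (\sum_(0 <= k < n) (a ^+ k) u) = u - (a ^+ n) u.
Proof.
elim: n => [|n IH]; first by rewrite big_geq// operator_lin0 expr0 operator1 subrr.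
rewrite big_nat_recr// operator_linD IH operatorB operator1 -operatorM -exprS.
by rewrite addrA subrK.
Qed.

(** If S_n is the n-th partial sum of the series and z its limit, then (1 - a) z - u = (1 - a)(z -
    S_n) - a^n u. Both terms tend to 0 in truncated L^1, the first by boundedness of 1 - a. *)
Lemma neumann_solution a tau u : radical eta a ->
  exists2 z : V, (forall t, tau < t -> z t = 0) &
    {ae mu, forall t, t <= tau -> (1 - a) z t = u t}.
Proof.
move=> [ac _]; have h0 : 0 < 1 / 2 :> R by rewrite divr_gt0.
have [lam lam0 aw] := ac _ h0.
have wfin := wnorm_fin_num tau (causal_funP u) lam0.
(* Powers of [a] decay like 2^-n in the norm weighted by [lam]; the exponential is the price of
   returning to weight 0. *)
pose K := expR (lam * tau) * fine (wnorm lam tau u).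
have K0 : 0 <= K by rewrite mulr_ge0 ?expR_ge0// fine_ge0// wnorm_ge0.
pose v n := (a ^+ n) u.
have vK n : (wnorm 0 tau (v n) <= (K / 2 ^+ n)%:E)%E.
  apply: le_trans (wnorm0_le_wnorm _ (measurable_causal_fun _) lam0) _.
  rewrite /K -mulrA EFinM lee_wpmul2l ?lee_fin ?expR_ge0//.
  rewrite mulrC -[_^-1]mul1r EFinM fineK//.
  by apply: contracting_expr => x; exact: aw.
have [z z0 zv] := causal_complete K0 vK.
exists z => //.
suff : {ae mu, forall t, t <= tau -> ((1 - a) z - u) t = 0}.
  by apply: ae_imp => t + tt => /(_ tt)/eqP; rewrite causal_funB subr_eq0 => /eqP.
apply/(wnorm_eq0P 0 _ (measurable_causal_fun _)).
apply/eqP; rewrite eq_le wnorm_ge0 andbT; apply/lee_addgt0Pr => eps e0; rewrite add0e.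
have [_ _ [C C0 aC] _] := operatorP (1 - a).
have C1 : 0 < C + 1 by rewrite ltr_wpDl.
(* Chosen so that C e1 <= eps / 2. *)
pose e1 := eps / (2 * (C + 1)); have e10 : 0 < e1 by rewrite divr_gt0// mulr_gt0.
have e20 : 0 < eps / 2 by rewrite divr_gt0.
have Kcvg : K / 2 ^+ n @[n --> \oo] --> (0 : R).
  rewrite -[0](mulr0 K); apply: cvgM; first exact: cvg_cst.
  rewrite (_ : (fun n => _) = (fun n => (2^-1 : R) ^+ n)).
    by apply: cvg_expr; rewrite ger0_norm ?invr_ge0// invf_lt1// ltr1n.
  by apply/funext => n; rewrite exprVn.
move/cvgrPdist_le : Kcvg => /(_ _ e20) Kcvg.
near \oo => n.
have e : (1 - a) (z - \sum_(0 <= k < n) v k) = (1 - a) z - (u - v n).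
  apply: etrans (operator_linB _ _ _) _.
  by congr (_ - _); exact: neumann_partial.
have -> : (1 - a) z - u = (1 - a) (z - \sum_(0 <= k < n) v k) - v n.
  rewrite e; move: (v n) ((1 - a) z) => w p.
  by rewrite opprB addrA addrAC addrK.
apply: le_trans (wnormB _ _ _ _) _.
rewrite [eps]splitr EFinD; apply: leeD.
  apply: le_trans (aC _ _ _ (lexx 0)) _.
  apply: (@le_trans _ _ (C%:E * e1%:E)%E).
    rewrite lee_wpmul2l ?lee_fin//; near: n; exact: zv.
  rewrite -EFinM lee_fin /e1 (_ : C * (eps / (2 * (C + 1))) = C / (C + 1) * (eps / 2)).
    by rewrite ler_piMl ?(ltW e20)// ler_pdivrMr// mul1r lerDl.
  by field; rewrite gt_eqF.
apply: le_trans (vK n) _; rewrite lee_fin.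
have : `|0 - K / 2 ^+ n| <= eps / 2 by near: n.
by rewrite sub0r normrN; exact: le_trans (ler_norm _).
Unshelve. all: by end_near. Qed.

(* The equation [z = u + a z] propagates local integrability forward in time by
   steps of length [eta]. *)
Lemma neumann_Lq a tau u z : 0 < q -> 0 < eta -> radical eta a ->
  {ae mu, forall t, t <= tau -> (1 - a) z t = u t} ->
  Lq_upto q tau u -> Lq_upto q tau z.
Proof.
move=> q0 eta0 [_ asm] zu Lu.
have mV x := measurable_causal_fun x.
have L0 tau' : Lq_upto q tau' (0 : V).
  apply: (@Lq_upto_bounded R q tau' 0 _ q0 (mV 0)) => t; rewrite causal_fun0//.
  by rewrite normr0.
(* The offset -1 confines the base case to negative times, where [z] is zero. *)
have step n : Lq_upto q (Num.min tau (n%:R * eta - 1)) z.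
  elim: n => [|n IH].
    apply: (Lq_upto_ae (mV 0) (mV z) _ (L0 _)).
    apply: aeW => t; rewrite mul0r sub0r le_min => /andP[_ t1].
    by have [_ ->] := causal_funP z; rewrite ?causal_fun0//; lra.
  have Lu' : Lq_upto q (Num.min tau (n.+1%:R * eta - 1)) u.
    by apply: (Lq_upto_le (mV u) _ Lu); rewrite ge_min lexx.
  have Laz : Lq_upto q (Num.min tau (n.+1%:R * eta - 1)) (a z).
    apply: (Lq_upto_le (mV (a z)) _ (asm q0 _ _ IH)).
    rewrite -natr1; case: (leP tau (n%:R * eta - 1)) => h.
      by rewrite ge_min (_ : tau <= tau + eta) ?orTb// lerDl ltW.
    by rewrite ge_min; apply/orP; right; lra.
  apply: (Lq_upto_ae (mV (u - (0 - a z))) (mV z)).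
    apply: ae_imp zu => t zu; rewrite le_min !causal_funB causal_fun0 => /andP[/zu <- _].
    by rewrite sub0r opprK operatorB operator1 causal_funB subrK.
  exact: (Lq_uptoB (ltW q0) Lu' (Lq_uptoB (ltW q0) (L0 _) Laz)).
(* With n steps, n > (|tau| + 1) / eta, the horizon n eta - 1 exceeds [tau]. *)
apply: (Lq_upto_le (mV z) _ (step (Num.truncn ((`|tau| + 1) / eta)).+1)).
rewrite le_min lexx/=.
have : (`|tau| + 1) / eta < (Num.truncn ((`|tau| + 1) / eta)).+1%:R by exact: truncnS_gt.
rewrite ltr_pdivrMr// => h; have := ler_norm tau; lra.
Qed.

End NeumannSolution.

(** * Vector-valued L^q functions and truncation *)

Section MatrixNorm.
Variable R : realType.
Local Notation mu := (@lebesgue_measure R).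

Lemma mx_normE_max (m n : nat) (M : 'M[R]_(m, n)) :
  `|M| = \big[Num.max/0]_ij `|M ij.1 ij.2|.
Proof. by rewrite -mx_normrE. Qed.

Lemma le_mx_norm (m n : nat) (M : 'M[R]_(m, n)) i j : `|M i j| <= `|M|.
Proof.
by rewrite mx_normE_max; apply/bigmax_geP; right => /=; exists (i, j).
Qed.

Lemma measurable_mx_norm (D : set R) n (f : R -> 'cV[R]_n) :
  (forall i, measurable_fun D (fun s => f s i 0)) ->
  measurable_fun D (fun s => `|f s|).
Proof.
move=> mf; have -> : (fun s => `|f s|) =
    (fun s => \big[Num.max/0]_(ij <- index_enum ('I_n * 'I_1)%type) `|f s ij.1 ij.2|).
  by apply/funext => s; exact: mx_normE_max.
elim: (index_enum _) => [|ij r IH].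
  rewrite (_ : (fun s => _) = cst 0); first exact: measurable_cst.
  by apply/funext => s; rewrite big_nil.
rewrite (_ : (fun s => _) = (fun s => `|f s ij.1 ij.2|) \max
    (fun s => \big[Num.max/0]_(ij <- r) `|f s ij.1 ij.2|)); last first.
  by apply/funext => s; rewrite big_cons.
apply: measurable_maxr => //; apply: measurableT_comp => //.
by have := mf ij.1; rewrite [ij.2]ord1.
Qed.

Lemma powR_mx_norm_le n (v : 'cV[R]_n) q : 0 < q ->
  `|v| `^ q <= \sum_i `|v i 0| `^ q.
Proof.
move=> q0; have [v0|v0] := eqVneq (`|v|) 0.
  by rewrite v0 powR0 ?gt_eqF// sumr_ge0// => i _; exact: powR_ge0.
have [[i j] /= vE] := mx_norm_neq0 v0.
rewrite [X in X `^ q](_ : `|v| = `|v i 0|); last by rewrite (ord1 j) in vE.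
by rewrite (bigD1 i)//= lerDl sumr_ge0// => k _; exact: powR_ge0.
Qed.

(** The maximum norm dominates each entry, and its [q]-th power is at most the sum of those of the
    entries. L^q membership can therefore be tested on the scalar components, on which the operators
    act. *)
Lemma inLqP (D : set R) q n (f : R -> 'cV[R]_n) : measurable D -> 0 < q ->
  inLq D q f <-> forall i, measurable_fun D (fun s => f s i 0) /\
    (\int[mu]_(s in D) (`|f s i 0%R| `^ q)%:E < +oo)%E.
Proof.
move=> mD q0.
have mpow i : measurable_fun D (fun s => f s i 0) ->
    measurable_fun D (fun s => `|f s i 0| `^ q).
  move=> mf; apply: (measurableT_comp (@measurable_powR R q)).
  exact: measurableT_comp.
split=> [[mf foo] i|H].
  split=> //; apply: le_lt_trans foo; apply: ge0_le_integral => //.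
  - by apply/measurable_EFinP; exact: mpow.
  - apply/measurable_EFinP; apply: (measurableT_comp (@measurable_powR R q)).
    exact: measurable_mx_norm.
  - move=> s _; rewrite lee_fin ge0_ler_powR ?nnegrE ?(ltW q0)//.
    exact: le_mx_norm.
have mf i := (H i).1; split=> //.
apply: (@le_lt_trans _ _ (\int[mu]_(s in D) \sum_i (`|f s i 0%R| `^ q)%:E)%E).
  apply: ge0_le_integral => //.
  - apply/measurable_EFinP; apply: (measurableT_comp (@measurable_powR R q)).
    exact: measurable_mx_norm.
  - apply: emeasurable_sum => i; apply/measurable_EFinP; exact: mpow.
  - by move=> s _; rewrite sumEFin lee_fin powR_mx_norm_le.
rewrite ge0_integral_sum//; last first.
  by move=> i; apply/measurable_EFinP; exact: mpow.
by apply: lte_sum_pinfty => i _; exact: (H i).2.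
Qed.

End MatrixNorm.

Section Truncation.
Variable R : realType.
Local Notation mu := (@lebesgue_measure R).

(** The left end is excluded: for [a = 0] the initial condition already fixes the trajectory to be 0
    there. *)
Definition truncate_to (a b : R) (y : R -> R) t := if a < t <= b then y t else 0.

Lemma measurable_truncate (a b : R) (y : R -> R) (D : set R) : measurable D ->
  (forall t, a < t <= b -> D t) -> measurable_fun D y ->
  measurable_fun setT (truncate_to a b y).
Proof.
move=> mD Dab my.
rewrite (_ : truncate_to a b y = y \_ (`]a, b]%classic)); last first.
  apply/funext => t; rewrite /truncate_to /patch.
  by congr (if _ then _ else _); apply/idP/idP => [|/set_mem]; rewrite ?inE /= in_itv.
apply: (measurable_restrictT _ (measurable_itv _)).1.
by apply: measurable_funS my => // t; rewrite /= in_itv; exact: Dab.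
Qed.

Lemma Lq_upto_truncate (a b q tau : R) (y : R -> R) (D : set R) : measurable D ->
  0 < q -> (forall t, a < t <= b -> D t) -> measurable_fun D y ->
  (\int[mu]_(s in D) (`|y s| `^ q)%:E < +oo)%E -> Lq_upto q tau (truncate_to a b y).
Proof.
move=> mD q0 Dab my yoo; apply: le_lt_trans yoo; rewrite [leRHS]integral_mkcond.
apply: ge0_le_integral => //.
- by move=> t _; rewrite lee_fin lq_density_ge0.
- apply/measurable_EFinP; apply: measurable_lq_density.
  exact: measurable_truncate Dab my.
- apply: (measurable_restrictT _ mD).1; apply/measurable_EFinP.
  by apply: (measurableT_comp (@measurable_powR R q)); exact: measurableT_comp.
- move=> t _; rewrite /lq_density /truncate_to /patch.
  have h : (0 <= if t \in D then (`|y t| `^ q)%:E else 0)%E.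
    by case: ifP => _ //; rewrite lee_fin powR_ge0.
  case: ifP => _ //; case: ifP => tab; last by rewrite normr0 powR0 ?gt_eqF.
  by rewrite mem_set//; exact: Dab.
Qed.

(** L^q lies in L^1 on a bounded interval, since |y| <= 1 + |y|^q for [1 <= q]. *)
Lemma causal_truncate (a b q : R) (y : R -> R) (D : set R) : measurable D ->
  0 <= a -> 1 <= q -> (forall t, a < t <= b -> D t) -> measurable_fun D y ->
  (\int[mu]_(s in D) (`|y s| `^ q)%:E < +oo)%E ->
  causal_integrable (truncate_to a b y).
Proof.
move=> mD a0 q1 Dab my yoo; have q0 : 0 < q by apply: lt_le_trans q1.
have mt := measurable_truncate mD Dab my.
split; last first.
  by move=> t t0; rewrite /truncate_to ltNge (le_trans (ltW t0) a0).
apply/integrableP; split; first exact/measurable_EFinP.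
have Lt := Lq_upto_truncate b mD q0 Dab my yoo.
apply: (@le_lt_trans _ _ (\int[mu]_t ((\1_`[a, b] t)%:E
    + (lq_density q b (truncate_to a b y) t)%:E))%E).
  apply: ge0_le_integral => //.
  - by apply/measurable_EFinP; exact: measurableT_comp.
  - apply: emeasurable_funD; apply/measurable_EFinP => //.
    exact: measurable_lq_density.
  - move=> t _; rewrite /= -EFinD lee_fin.
    have l0 := lq_density_ge0 q b (truncate_to a b y) t.
    have [tab|tab] := boolP (a < t <= b); last first.
      by rewrite {1}/truncate_to (negbTE tab) normr0 addr_ge0.
    have /andP[/ltW at_ tb] := tab.
    rewrite indicE mem_set; last by rewrite /= in_itv/= at_ tb.
    rewrite /lq_density tb; set r := `|_|; have r0 : 0 <= r := normr_ge0 _.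
    have [r1|r1] := leP r 1; first by rewrite -[leLHS]addr0 lerD// powR_ge0.
    rewrite -[leLHS]add0r lerD//; rewrite -[leLHS]powRr1//.
    exact: ler_powR (ltW r1) _ _ q1.
rewrite ge0_integralD//; last 2 first.
- by move=> t _; rewrite lee_fin lq_density_ge0.
- by apply/measurable_EFinP; exact: measurable_lq_density.
  apply: lte_add_pinfty => //; rewrite integral_indic//= setIT.
  by rewrite lebesgue_measure_itv/=; case: ifP => _; rewrite -?EFinB ltry.
exact/measurable_EFinP.
Qed.

Lemma Lq_upto_support (q tau tau' : R) (x : R -> R) : 0 < q ->
  measurable_fun setT x -> (forall t, tau < t -> x t = 0) ->
  Lq_upto q tau x -> Lq_upto q tau' x.
Proof.
move=> q0 mx x0; apply: le_lt_trans; apply: ge0_le_integral_EFin.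
- exact: lq_density_ge0.
- exact: measurable_lq_density.
- exact: measurable_lq_density.
- move=> t; rewrite /lq_density; case: (leP t tau) => [tt|/x0 ->].
    by case: ifP => // _; exact: powR_ge0.
  by rewrite normr0 powR0 ?gt_eqF// if_same.
Qed.

Lemma integral_le_Lq_upto (a b q : R) (x : R -> R) : measurable_fun setT x ->
  Lq_upto q b x -> (\int[mu]_(t in `[a, b]) (`|x t| `^ q)%:E < +oo)%E.
Proof.
move=> mx; apply: le_lt_trans; rewrite integral_mkcond.
apply: ge0_le_integral => //.
- by move=> t _; rewrite /patch; case: ifP => _ //; rewrite lee_fin powR_ge0.
- apply: (measurable_restrictT _ (measurable_itv _)).1.
  apply/measurable_EFinP; apply: measurable_funTS.
  by apply: (measurableT_comp (@measurable_powR R q)); exact: measurableT_comp.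
- by apply/measurable_EFinP; exact: measurable_lq_density.
- move=> t _; rewrite /patch; case: ifPn => [/set_mem|_].
    by rewrite /= in_itv/= /lq_density => /andP[_ ->].
  by rewrite lee_fin lq_density_ge0.
Qed.

End Truncation.

(** * Matrices of operators *)

Section MatrixAction.
Variables (R : realType) (q : R).
Local Notation mu := (@lebesgue_measure R).
Local Notation V := (causal_fun R).
Local Notation op := (operator q).

(** Causal functions form a module over the ring of operators and are not elements of it, so the
    action on a column of functions is separate from [*m]. *)
Definition mxact m n (M : 'M[op]_(m, n)) (x : 'I_n -> V) (i : 'I_m) : V :=
  \sum_j M i j (x j).

Lemma mxactM m n p (M : 'M[op]_(m, n)) (N : 'M[op]_(n, p)) x i :
  mxact (M *m N) x i = mxact M (mxact N x) i.
Proof.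
rewrite /mxact.
under eq_bigr => j _ do rewrite mxE operator_sum.
rewrite exchange_big/=; apply: eq_bigr => k _.
by rewrite operator_lin_sum.
Qed.

Lemma mxact_scalar n (f : op) (x : 'I_n -> V) i : mxact f%:M x i = f (x i).
Proof.
rewrite /mxact (bigD1 i)//= mxE eqxx mulr1n big1 ?addr0// => j ji.
by rewrite mxE eq_sym (negbTE ji) mulr0n operator0.
Qed.

Lemma mxactB m n (M : 'M[op]_(m, n)) (x y : 'I_n -> V) i :
  mxact M (fun j => x j - y j) i = mxact M x i - mxact M y i.
Proof.
by rewrite /mxact -sumrB; apply: eq_bigr => j _; exact: operator_linB.
Qed.

Lemma ae_sum_eq0 n (F : 'I_n -> V) tau :
  (forall j, {ae mu, forall t, t <= tau -> F j t = 0}) ->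
  {ae mu, forall t, t <= tau -> (\sum_j F j) t = 0}.
Proof.
move=> F0; apply: (big_ind (fun y : V => {ae mu, forall t, t <= tau -> y t = 0})).
- by apply: aeW => t _; rewrite causal_fun0.
- move=> x y; apply: ae_imp2 => t x0 y0 tt.
  by rewrite causal_funD x0// y0// addr0.
- by move=> j _; exact: F0.
Qed.

Lemma mxact_ae_causal m n (M : 'M[op]_(m, n)) (x : 'I_n -> V) tau :
  (forall j, {ae mu, forall t, t <= tau -> x j t = 0}) ->
  forall i, {ae mu, forall t, t <= tau -> mxact M x i t = 0}.
Proof.
move=> x0 i; apply: ae_sum_eq0 => j; exact: operator_ae_causal (x0 j).
Qed.

Lemma Lq_upto0 tau : 0 < q -> Lq_upto q tau (0 : V).
Proof.
move=> q0; apply: (@Lq_upto_bounded R q tau 0 _ q0 (measurable_causal_fun 0)) => t;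
  by rewrite causal_fun0 ?normr0.
Qed.

Lemma Lq_uptoDV tau (x y : V) : 0 < q ->
  Lq_upto q tau x -> Lq_upto q tau y -> Lq_upto q tau (x + y).
Proof.
move=> q0 Lx Ly.
have := Lq_uptoD (ltW q0) (measurable_causal_fun x) (measurable_causal_fun y) Lx Ly.
by [].
Qed.

Lemma mxact_Lq m n (M : 'M[op]_(m, n)) (x : 'I_n -> V) tau : 0 < q ->
  (forall j, Lq_upto q tau (x j)) -> forall i, Lq_upto q tau (mxact M x i).
Proof.
move=> q0 Lx i; apply: (big_ind (fun y : V => Lq_upto q tau y)).
- exact: (Lq_upto0 tau q0).
- by move=> y z Ly Lz; exact: (Lq_uptoDV q0 Ly Lz).
- move=> j _; have [_ _ _ Mq] := operatorP (M i j); exact: (Mq q0 _ _ (Lx j)).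
Qed.

Lemma mxact_spread L k m n (M : 'M[op]_(m, n)) (x : 'I_n -> V) tau t i :
  (forall i j, spread L k (M i j)) ->
  (forall j t, tau < t -> x j t = 0) -> tau + k%:R * L < t -> mxact M x i t = 0.
Proof.
move=> sM x0 tt; rewrite /mxact causal_fun_sum big1// => j _.
exact: (sM i j tau _ (x0 j) t tt).
Qed.

(** Uniqueness shows that a trajectory is zero up to [tau] only almost everywhere, whereas the
    initial condition in [is_solution] is pointwise; the cutoff repairs the difference. *)
Definition cutoff tau (x : V) : V := to_causal (fun t => if tau < t then x t else 0).

Lemma cutoffE tau x t : cutoff tau x t = if tau < t then x t else 0.
Proof.
have [ix x0] := causal_funP x.
rewrite /cutoff to_causalE//; split; last by move=> s s0; rewrite x0// if_same.
have ms : measurable_fun setT (fun s : R => if tau < s then x s else 0).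
  apply: measurable_fun_ifT => //; first exact: measurable_fun_ltr.
  exact: measurable_causal_fun.
apply: (le_integrable measurableT _ _ ix); first exact/measurable_EFinP.
by move=> s _; rewrite !abse_EFin lee_fin; case: ifP => // _; rewrite normr0.
Qed.

End MatrixAction.

(** * Replacing a trajectory by one that starts later and has the same final state *)

Section Reduction.
Variables (R : realType) (q eta L : R) (d m : nat).
Local Notation mu := (@lebesgue_measure R).
Local Notation V := (causal_fun R).
Local Notation op := (operator q).
Hypotheses (q0 : 0 < q) (eta0 : 0 < eta) (L0 : 0 <= L).
Variables (Q : 'M[op]_d) (B : 'M[op]_(d, m)).
Hypothesis radQ : forall i j, radical eta ((1%:M - Q) i j).
Hypothesis sQ : forall i j, spread L 1 (Q i j).
Hypothesis sB : forall i j, spread L 0 (B i j).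

(* If [\det Q z = U] on [t <= tau] and [z = 0] afterwards, then
   [X - \adj Q B z] solves the system for the control [U - \det Q z]: both vanish
   up to [tau], while the state is unchanged after [tau + d L]. *)
Lemma control_reduction (X : 'I_d -> V) (U : 'I_m -> V) (tau T : R) : tau <= T ->
  (forall i, {ae mu, forall t, t <= T -> mxact Q X i t = mxact B U i t}) ->
  (forall i, Lq_upto q T (X i)) -> (forall k, Lq_upto q T (U k)) ->
  exists X' : 'I_d -> V, exists U' : 'I_m -> V,
  [/\ forall i, {ae mu, forall t, t <= T -> mxact Q X' i t = mxact B U' i t},
      forall i t, t <= tau -> X' i t = 0,
      forall i t, tau + d%:R * L < t -> X' i t = X i t,
      forall i, Lq_upto q T (X' i)
    & forall k, Lq_upto q T (U' k)].
Proof.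
move=> tT QX LX LU; pose p := \det Q; pose a := 1 - p.
have pE : p = 1 - a by rewrite /a opprB addrC subrK.
have ra : radical eta a.
  have := radical_det radQ.
  by rewrite (_ : 1%:M - (1%:M - Q) = Q)// opprB addrC subrK.
have /choice[z hz] : forall k, exists z : V, (forall t, tau < t -> z t = 0) /\
    {ae mu, forall t, t <= tau -> (1 - a) z t = U k t}.
  by move=> k; have [z z1 z2] := neumann_solution tau (U k) ra; exists z.
have z0 k t : tau < t -> z k t = 0 by have [+ _] := hz k; exact.
have zU k : {ae mu, forall t, t <= tau -> p (z k) t = U k t}.
  by have [_] := hz k; rewrite -pE.
have LUt k : Lq_upto q tau (U k).
  exact: (Lq_upto_le (measurable_causal_fun (U k)) tT (LU k)).
have Lz k : Lq_upto q T (z k).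
  have zU' : {ae mu, forall t, t <= tau -> (1 - a) (z k) t = U k t}.
    by rewrite -pE; exact: zU.
  have Lzt := neumann_Lq q0 eta0 ra zU' (LUt k).
  exact: (Lq_upto_support T q0 (measurable_causal_fun (z k)) (z0 k) Lzt).
pose W := \adj Q *m B.
pose Y i := X i - mxact W z i.
pose U' k := U k - p (z k).
have LU' k : Lq_upto q T (U' k).
  have [_ _ _ pq] := operatorP p.
  exact: (Lq_uptoB (ltW q0) (LU k) (pq q0 _ _ (Lz k))).
have LY i : Lq_upto q T (Y i).
  exact: (Lq_uptoB (ltW q0) (LX i) (mxact_Lq W q0 Lz i)).
(* As Q (\adj Q) B = B p, the corrections of the state and of the control cancel in the equation. *)
have QY i : mxact Q Y i - mxact B U' i = mxact Q X i - mxact B U i.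
  have -> : mxact Q Y i = mxact Q X i - mxact (Q *m W) z i.
    by rewrite mxactM; exact: mxactB.
  have -> : mxact B U' i = mxact B U i - mxact (B *m p%:M) z i.
    rewrite mxactM (_ : mxact p%:M z = (fun k => p (z k))); last first.
      by apply/funext => k; exact: mxact_scalar.
    exact: mxactB.
  have -> : Q *m W = B *m p%:M by rewrite /W mulmxA mul_mx_adj scalar_mxC.
  by rewrite opprD opprK addrACA addNr addr0.
have aeQY i : {ae mu, forall t, t <= T -> mxact Q Y i t = mxact B U' i t}.
  apply: ae_imp (QX i) => t QXt /QXt /eqP; rewrite -subr_eq0 -causal_funB -QY.
  by rewrite causal_funB subr_eq0 => /eqP.
have U'0 k : {ae mu, forall t, t <= tau -> U' k t = 0}.
  apply: ae_imp (zU k) => t zUt /zUt; rewrite causal_funB => ->.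
  by rewrite subrr.
(* Up to [tau], p Y = (\adj Q) Q Y = (\adj Q) B U' = 0, and p = 1 - a with [a] in the ideal. *)
have Y0 i : {ae mu, forall t, t <= tau -> Y i t = 0}.
  apply: (radical_unique ra); rewrite -pE.
  rewrite -[p (Y i)](mxact_scalar p) -mul_adj_mx mxactM.
  apply: mxact_ae_causal => j.
  apply: ae_imp2 (aeQY j) (mxact_ae_causal B U'0 j) => t e1 e2 tt.
  by rewrite e1 ?e2// (le_trans tt tT).
pose X' i := cutoff tau (Y i).
have XY i : {ae mu, forall t, t <= T -> (X' i - Y i) t = 0}.
  apply: ae_imp (Y0 i) => t Yt _; rewrite causal_funB cutoffE.
  by case: ltP => [_|/Yt ->]; rewrite subrr.
exists X', U'; split.
- move=> i; apply: ae_imp2 (aeQY i) (mxact_ae_causal Q XY i) => t e1 e2 tt.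
  rewrite -e1//; have := e2 tt; rewrite mxactB causal_funB => /eqP.
  by rewrite subr_eq0 => /eqP.
- by move=> i t tt; rewrite cutoffE ltNge tt.
- move=> i t tt; rewrite cutoffE ifT; last first.
    by apply: le_lt_trans tt; rewrite lerDl mulr_ge0.
  (* [z] is zero after [tau], and the entries of \adj Q and B have spreads [d] and 0, so the
     correction is zero after tau + d L. *)
  rewrite causal_funB (@mxact_spread _ _ L d _ _ _ _ tau) ?subr0// => i' j.
  rewrite mxE; apply: (big_ind (spread L d)) => [||k _]; first exact: spread0.
    by move=> f g; exact: spreadD.
  by rewrite -[d in spread L d]addn0; apply: spreadM => //; exact: spread_adj.
- move=> i.
  have XYt : {ae mu, forall t, t <= T -> Y i t = X' i t}.
    apply: ae_imp (XY i) => t e /e /eqP; rewrite causal_funB subr_eq0 => /eqP ->.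
    by [].
  exact: (Lq_upto_ae (measurable_causal_fun _) (measurable_causal_fun _) XYt (LY i)).
- exact: LU'.
Qed.

End Reduction.

(** * The difference-delay system *)

Section TruncatedKernel.
Variable R : realType.
Local Notation mu := (@lebesgue_measure R).
Implicit Types (k y : R -> R) (L M : R).

(* An essentially bounded kernel is made bounded everywhere, so that its convolution
   with an integrable function is defined at every point. *)
Definition trunc_kernel L M k s : R :=
  let h := (k \_ (`[0, L]%classic)) s in if `|h| <= `|M| then h else 0.

(** The absolute value of [M] makes the bound hold where the kernel is 0, whatever the sign of
    [M]. *)
Lemma bounded_trunc_kernel L M k : measurable_fun `[0, L]%classic k ->
  bounded_kernel L `|M| (trunc_kernel L M k).
Proof.
move=> mk.
have mh : measurable_fun setT (k \_ (`[0, L]%classic)).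
  exact: (measurable_restrictT _ (measurable_itv _)).1.
split.
- apply: measurable_fun_ifT => //; apply: measurable_fun_ler => //.
  exact: measurableT_comp.
- by move=> s; rewrite /trunc_kernel /=; case: ifP => // _; rewrite normr0.
- move=> s sL; rewrite /trunc_kernel /patch memNset ?normr0 ?if_same//=.
  by rewrite in_itv/=; exact/negP.
Qed.

Lemma Rintegral_trunc_kernel L M k y : measurable_fun `[0, L]%classic k ->
  measurable_fun setT y ->
  {ae mu, forall s, `[0, L]%classic s -> `|k s| <= `|M|} ->
  (\int[mu]_(s in `[0, L]) (k s * y s) = \int[mu]_s (trunc_kernel L M k s * y s))%R.
Proof.
move=> mk my kM; have [mt _ _] := bounded_trunc_kernel M mk.
rewrite Rintegral_mkcond /Rintegral; congr fine.
apply: ae_eq_integral => //.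
- apply/measurable_EFinP; apply: (measurable_restrictT _ (measurable_itv _)).1.
  by apply: measurable_funM => //; exact: measurable_funTS.
- by apply/measurable_EFinP; exact: measurable_funM.
- apply: ae_imp kM => s ks _; congr (_%:E); rewrite /trunc_kernel /patch.
  by case: ifPn => [/set_mem/ks ->//|_]; rewrite normr0 normr_ge0 mul0r.
Qed.

End TruncatedKernel.

(** * The system as a matrix equation over the ring of operators *)

Section System.
Variables (R : realType) (q : R) (d m N : nat) (Lam : nat -> R).
Variables (A : nat -> 'M[R]_d) (B : 'M[R]_(d, m)) (g : R -> 'M[R]_d) (M : R).
Local Notation mu := (@lebesgue_measure R).
Local Notation V := (causal_fun R).
Local Notation op := (operator q).
Hypothesis Lam_gt0 : forall l, (1 <= l < N.+1)%N -> 0 < Lam l.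
Hypothesis Lam_le : forall l, (1 <= l < N.+1)%N -> Lam l <= Lam N.
Hypothesis Lam1_le : forall l, (1 <= l < N.+1)%N -> Lam 1 <= Lam l.
Hypothesis N_gt0 : (0 < N)%N.
Hypothesis mg : forall i j, measurable_fun `[0, Lam N]%classic (fun s => g s i j).
Hypothesis gM : {ae mu, forall s, `[0, Lam N]%classic s -> `|g s| <= M}.

Definition entry_kernel i j := trunc_kernel (Lam N) M (fun s => g s i j).

Definition delay_mx : 'M[op]_d := \matrix_(i, j)
  (\sum_(1 <= l < N.+1) scale_op q (A l i j) * delay_op q (Lam l)
   + convol_op q (entry_kernel i j)).

Definition system_mx : 'M[op]_d := 1%:M - delay_mx.

Definition input_mx : 'M[op]_(d, m) := \matrix_(i, k) scale_op q (B i k).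

Let LamN_gt0 : 0 < Lam N.
Proof. by apply: Lam_gt0; rewrite N_gt0 ltnSn. Qed.

Let kern i j : bounded_kernel (Lam N) `|M| (entry_kernel i j).
Proof. exact: bounded_trunc_kernel. Qed.

(** The smallest delay [Lam 1] is a gain common to all the delays, and convolutions allow any
    gain. *)
Lemma radical_system i j : radical (Lam 1) ((1%:M - system_mx) i j).
Proof.
rewrite (_ : 1%:M - system_mx = delay_mx); last by rewrite /system_mx opprB addrC subrK.
rewrite mxE; apply: radicalD; last exact: radical_convol (ltW LamN_gt0) (kern i j).
rewrite big_nat_cond; apply: radical_sum => l /andP[lN _]; apply: radicalMl.
exact: radical_delay (Lam_gt0 lN) (Lam1_le lN).
Qed.

Lemma spread_system i j : spread (Lam N) 1 (system_mx i j).
Proof.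
rewrite /system_mx !mxE; apply: spreadD.
  apply: (spread_le (ltW LamN_gt0) (leq0n 1)).
  by case: (i == j); [exact: spread1|exact: spread0].
apply: spreadN; apply: spreadD; last exact: spread_convol (ltW LamN_gt0) (kern i j).
rewrite big_nat_cond; apply: (big_ind (spread (Lam N) 1)); first exact: spread0.
  by move=> f h; exact: spreadD.
move=> l /andP[lN _]; rewrite -[1%N]add0n; apply: spreadM; first exact: spread_scale.
exact: spread_delay (ltW (Lam_gt0 lN)) (Lam_le lN).
Qed.

Lemma spread_input i k : spread (Lam N) 0 (input_mx i k).
Proof. by rewrite mxE; exact: spread_scale. Qed.

Lemma system_mxactE (X : 'I_d -> V) i t : mxact system_mx X i t = X i t -
  \sum_j (\sum_(1 <= l < N.+1) A l i j * X j (t - Lam l)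
          + convol (entry_kernel i j) (X j) t).
Proof.
have -> : mxact system_mx X i = X i - mxact delay_mx X i.
  rewrite -[X i](operator1 q) -(mxact_scalar 1) /mxact -sumrB.
  by apply: eq_bigr => j _; rewrite /system_mx !mxE operatorB.
rewrite causal_funB causal_fun_sum; congr (_ - _); apply: eq_bigr => j _.
rewrite mxE operatorD causal_funD; congr (_ + _); last first.
  by rewrite (convol_opE _ _ (ltW LamN_gt0) (kern i j))
    (convol_funE _ _ (ltW LamN_gt0) (kern i j)).
rewrite operator_sum causal_fun_sum; apply: eq_big_nat => l lN.
have l0 := ltW (Lam_gt0 lN).
by rewrite operatorM scale_opE scale_funE delay_opE// delay_funE.
Qed.

Lemma input_mxactE (U : 'I_m -> V) i t :
  mxact input_mx U i t = \sum_k B i k * U k t.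
Proof.
rewrite /mxact causal_fun_sum; apply: eq_bigr => k _.
by rewrite mxE scale_opE scale_funE.
Qed.

(** Only the memory window of length [Lam N] before [t] matters. The shift [sg] serves both
    directions: it is 0 to read off a given solution, and the start of motion to write the new
    one. *)
Lemma rhs_mxact (x : R -> 'cV[R]_d) (u : R -> 'cV[R]_m) (X : 'I_d -> V)
    (U : 'I_m -> V) sg t i :
  (forall r j, t - Lam N <= r <= t -> x r j 0 = X j (r + sg)) ->
  (forall k, u t k 0 = U k (t + sg)) ->
  rhs N Lam A B g u x t i 0 =
    X i (t + sg) - mxact system_mx X i (t + sg) + mxact input_mx U i (t + sg).
Proof.
move=> xX uU; rewrite system_mxactE input_mxactE subKr.
rewrite /rhs !mxE; congr (_ + _); last by apply: eq_bigr => k _; rewrite uU.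
rewrite big_split/=; congr (_ + _).
  rewrite summxE exchange_big/=; apply: eq_big_nat => l lN.
  rewrite mxE; apply: eq_bigr => j _; congr (_ * _); rewrite xX.
    by congr (X j _); ring.
  by have := Lam_le lN; have := Lam_gt0 lN; move=> *; apply/andP; split; lra.
apply: eq_bigr => j _.
transitivity (\int[mu]_(s in `[0, Lam N]) (g s i j * X j (t + sg - s)))%R.
  apply: eq_Rintegral => s; rewrite inE/= in_itv/= => /andP[s0 sL].
  rewrite xX; first by congr (_ * X j _); ring.
  by apply/andP; split; lra.
apply: (Rintegral_trunc_kernel (k := fun s => g s i j)
  (y := fun s => X j (t + sg - s)) (mg i j)).
  apply: (measurableT_comp (measurable_causal_fun (X j))).
  exact: measurable_reflect.
apply: ae_imp gM => s gs /gs {}gs.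
exact: le_trans (le_mx_norm _ _ _) (le_trans gs (ler_norm _)).
Qed.

Lemma solution_to_mxact T (u : R -> 'cV[R]_m) (x : R -> 'cV[R]_d) : 1 <= q -> 0 < T ->
  inLq `[0, T]%classic q u -> is_solution q N Lam A B g T (fun=> 0) u x ->
  exists X : 'I_d -> V, exists U : 'I_m -> V,
  [/\ forall i, {ae mu, forall t, t <= T ->
        mxact system_mx X i t = mxact input_mx U i t},
      forall i t, t <= 0 -> X i t = 0,
      forall i t, - Lam N <= t <= T -> X i t = x t i 0,
      forall i, Lq_upto q T (X i)
    & forall k, Lq_upto q T (U k)].
Proof.
move=> q1 T0 /inLqP Lu [/inLqP Lx [x0 xe]]; have q0 : 0 < q by apply: lt_le_trans q1.
have {}Lu := Lu (measurable_itv _) q0; have {}Lx := Lx (measurable_itv _) q0.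
have D1 t : 0 < t <= T -> `[- Lam N, T]%classic t.
  by rewrite /= in_itv/= => /andP[t0 ->]; rewrite andbT; have := LamN_gt0; lra.
have D2 t : 0 < t <= T -> `[0, T]%classic t.
  by rewrite /= in_itv/= => /andP[/ltW -> ->].
pose X i : V := to_causal (truncate_to 0 T (fun t => x t i 0)).
pose U k : V := to_causal (truncate_to 0 T (fun t => u t k 0)).
have XE i t : X i t = truncate_to 0 T (fun t => x t i 0) t.
  rewrite /X to_causalE//; have [mx xoo] := Lx i.
  exact: (causal_truncate (measurable_itv _) (lexx 0) q1 D1 mx xoo).
have UE k t : U k t = truncate_to 0 T (fun t => u t k 0) t.
  rewrite /U to_causalE//; have [mu_ uoo] := Lu k.
  exact: (causal_truncate (measurable_itv _) (lexx 0) q1 D2 mu_ uoo).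
have Xx i t : - Lam N <= t <= T -> X i t = x t i 0.
  move=> /andP[t1 t2]; rewrite XE /truncate_to t2 andbT; case: ltP => // t0.
  by rewrite x0 ?mxE//= in_itv/= t1.
exists X, U; split.
- move=> i.
  (* Truncation sets the control to 0 at time 0, where [u] may be nonzero; this null set is
     discarded. At negative times both sides vanish by causality. *)
  have ne0 : {ae mu, forall t : R, t <> 0}.
    exists [set 0]; split; [exact: measurable_set1|exact: lebesgue_measure_set1|].
    by move=> t /= /contrapT.
  apply: ae_imp2 xe ne0 => t xt t0 tT.
  have [tn|tp|//] := ltgtP t 0.
    by have [_ ->] := causal_funP (mxact system_mx X i) => //;
      have [_ ->] := causal_funP (mxact input_mx U i).
  have tx : x t = rhs N Lam A B g u x t.
    by apply: xt; rewrite /= in_itv/= (ltW tp) tT.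
  have := rhs_mxact (x := x) (u := u) (X := X) (U := U) (sg := 0) (t := t) i.
  rewrite -tx !addr0 Xx; last by rewrite tT andbT; have := LamN_gt0; lra.
  move=> h.
  have {h} : x t i 0 = x t i 0 - mxact system_mx X i t + mxact input_mx U i t.
    apply: h.
      move=> r j /andP[r1 r2]; rewrite addr0 Xx//.
      by apply/andP; split; lra.
    by move=> k; rewrite UE /truncate_to tp tT.
  by move=> h; lra.
- by move=> i t t0; rewrite XE /truncate_to ltNge t0.
- exact: Xx.
- move=> i; rewrite (_ : X i = truncate_to 0 T (fun t => x t i 0) :> (R -> R)).
    have [mx xoo] := Lx i.
    exact: (Lq_upto_truncate T (measurable_itv _) q0 D1 mx xoo).
  by apply/funext => t; exact: XE.
- move=> k; rewrite (_ : U k = truncate_to 0 T (fun t => u t k 0) :> (R -> R)).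
    have [mu_ uoo] := Lu k.
    exact: (Lq_upto_truncate T (measurable_itv _) q0 D2 mu_ uoo).
  by apply/funext => t; exact: UE.
Qed.

(** The system is invariant under time translation, and vanishing up to [sg] becomes the zero
    initial condition after the shift. *)
Lemma mxact_to_solution T sg (X : 'I_d -> V) (U : 'I_m -> V) : 0 < q ->
  (forall i, {ae mu, forall t, t <= T + sg ->
     mxact system_mx X i t = mxact input_mx U i t}) ->
  (forall i t, t <= sg -> X i t = 0) ->
  (forall i, Lq_upto q (T + sg) (X i)) -> (forall k, Lq_upto q (T + sg) (U k)) ->
  inLq `[0, T]%classic q (fun t => \col_k U k (t + sg)) /\
  is_solution q N Lam A B g T (fun=> 0)
    (fun t => \col_k U k (t + sg)) (fun t => \col_i X i (t + sg)).
Proof.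
move=> q0 XU X0 LX LU.
have shift (y : V) : Lq_upto q (T + sg) y -> forall a,
    measurable_fun `[a, T]%classic (fun t => y (t + sg)) /\
    (\int[mu]_(t in `[a, T]) (`|y (t + sg)%R| `^ q)%:E < +oo)%E.
  move=> Ly a; have my : measurable_fun setT (fun t : R => y (t + sg)).
    have := measurable_translate (- sg) (measurable_causal_fun y).
    by rewrite (_ : (fun t => _) = (fun t => y (t + sg)))//; apply/funext => t; rewrite opprK.
  split; first exact: measurable_funTS.
  apply: integral_le_Lq_upto => //.
  have := Lq_upto_delay (- sg) (measurable_causal_fun y) Ly.
  rewrite addrK (_ : (fun t => _) = (fun t => y (t + sg)))//.
  by apply/funext => t; rewrite opprK.
split.
  apply/(inLqP _ (measurable_itv _) q0) => k.
  rewrite (_ : (fun s => _) = (fun t => U k (t + sg))); last first.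
    by apply/funext => t; rewrite mxE.
  have [mU Uoo] := shift _ (LU k) 0; split; first exact: mU.
  by under eq_integral do rewrite mxE.
split; [|split].
- apply/(inLqP _ (measurable_itv _) q0) => i.
  rewrite (_ : (fun s => _) = (fun t => X i (t + sg))); last first.
    by apply/funext => t; rewrite mxE.
  have [mX Xoo] := shift _ (LX i) (- Lam N); split; first exact: mX.
  by under eq_integral do rewrite mxE.
- move=> t; rewrite /= in_itv/= => /andP[_ t0]; apply/colP => i.
  by rewrite !mxE X0//; lra.
- have aeall : {ae mu, forall t, forall i, t <= T + sg ->
      mxact system_mx X i t = mxact input_mx U i t}.
    exact: ae_forall_ord.
  have := ae_translate sg aeall; apply: ae_imp => t h.
  rewrite /= in_itv/= => /andP[_ tT]; apply/colP => i.
  rewrite (rhs_mxact (X := X) (U := U) (sg := sg)).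
  + by rewrite mxE h ?lerD2r// subrK.
  + by move=> r j _; rewrite mxE.
  + by move=> k; rewrite mxE.
Qed.

End System.

Theorem theorem11 (R : realType) (d m N : nat)
  (hd : (0 < d)%N) (hm : (0 < m)%N) (hN : (0 < N)%N)
  (Lam : nat -> R) (hLam1 : 0 < Lam 1%N)
  (hLam : forall j : nat, (1 <= j < N)%N -> Lam j < Lam j.+1)
  (A : nat -> 'M[R]_d) (B : 'M[R]_(d, m)) (g : R -> 'M[R]_d)
  (hg : inLinf `[0, Lam N]%classic g)
  (q : R) (hq : 1 <= q) :
  approx_ctrl q N Lam A B g <->
  (forall T : R, 2 * d%:R * Lam N < T -> approx_ctrl_time q N Lam A B g T).
Proof.
have Lam1_le l : (1 <= l < N.+1)%N -> Lam 1 <= Lam l.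
  elim: l => // -[|l] IH /andP[_ lN] //.
  apply: le_trans (IH _) (ltW (hLam _ _)); rewrite /= ?(ltnW lN)//.
have Lam_gt0 l : (1 <= l < N.+1)%N -> 0 < Lam l.
  by move=> /Lam1_le; exact: lt_le_trans.
have Lam_le l : (1 <= l < N.+1)%N -> Lam l <= Lam N.
  move=> /andP[l1]; rewrite ltnS => lN.
  have : forall k, (l + k <= N)%N -> Lam l <= Lam (l + k)%N.
    elim=> [|k IH] lk; first by rewrite addn0.
    rewrite addnS; apply: le_trans (IH _) (ltW (hLam _ _)).
      by apply: leq_trans lk; rewrite leq_add2l.
    by rewrite -addnS lk andbT (leq_trans l1)// leq_addr.
  by move=> /(_ (N - l)%N); rewrite subnKC//; exact.
have LamN_gt0 : 0 < Lam N by apply: Lam_gt0; rewrite hN ltnSn.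
have q0 : 0 < q by apply: lt_le_trans hq.
have d1 : 1 <= d%:R :> R by rewrite ler1n.
split=> [ctrl T hT psi Lpsi eps e0|ctrl psi Lpsi eps e0]; last first.
  (* Any time above the threshold serves, the same for all targets and tolerances. *)
  exists (2 * d%:R * Lam N + 1); split.
    by rewrite ltr_wpDl// !mulr_ge0// ltW.
  by apply: ctrl => //; rewrite ltrDl.
have [mg [M gM]] := hg.
have [T1 [T10 [u [Lu [x [xs xpsi]]]]]] := ctrl psi Lpsi eps e0.
have [X [U [XU X0 Xx LX LU]]] :=
  solution_to_mxact Lam_gt0 Lam_le hN mg gM hq T10 Lu xs.
(* [1 <= d] gives 1 + d <= 2 d. *)
have dL : (1 + d%:R) * Lam N < T.
  by apply: le_lt_trans hT; rewrite ler_pM2r//; lra.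
suff [X' [U' [XU' X0' XX' LX' LU']]] : exists X' : 'I_d -> causal_fun R,
    exists U' : 'I_m -> causal_fun R,
    [/\ forall i, {ae lebesgue_measure, forall t, t <= T1 ->
          mxact (system_mx q N Lam A g M) X' i t = mxact (input_mx q B) U' i t},
        forall i t, t <= T1 - T -> X' i t = 0,
        forall i t, T1 - Lam N <= t -> X' i t = X i t,
        forall i, Lq_upto q T1 (X' i)
      & forall k, Lq_upto q T1 (U' k)].
  have TE : T + (T1 - T) = T1 by rewrite addrC subrK.
  have [] := @mxact_to_solution R q d m N Lam A B g M Lam_gt0 Lam_le hN mg gM T (T1 - T)
    X' U' q0; rewrite ?TE//.
  move=> Lu' xs'; exists (fun t => \col_k U' k (t + (T1 - T))).
  split; first exact: Lu'.
  exists (fun t => \col_i X' i (t + (T1 - T))).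
  split; first exact: xs'.
  suff -> : Lqnorm `[- Lam N, 0]%classic q
      (fun th => \col_i X' i (T + th + (T1 - T)) - psi th) =
    Lqnorm `[- Lam N, 0]%classic q (fun th => x (T1 + th) - psi th) by [].
  rewrite /Lqnorm; apply: (congr1 (fun w => poweR w q^-1)).
  apply: eq_integral => s; rewrite inE/= in_itv/= => /andP[s1 s2].
  have -> : \col_i X' i (T + s + (T1 - T)) = x (T1 + s); last by [].
  apply/colP => i; rewrite mxE.
  have -> : T + s + (T1 - T) = T1 + s by ring.
  by rewrite XX' ?Xx//; [apply/andP; split|]; lra.
(* If [T1 <= T], the shift T1 - T is nonpositive and the given trajectory is simply preceded by
   rest. *)
have [TT|TT] := leP T1 T.
  exists X, U; split; [exact: XU| |by []|exact: LX|exact: LU].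
  by move=> i t tt; apply: X0; lra.
have T1T : T1 - T <= T1.
  by rewrite gerBl (le_trans _ (ltW dL))// mulr_ge0 ?(ltW LamN_gt0)// addr_ge0.
have rQ i j : radical (Lam 1) ((1%:M - system_mx q N Lam A g M) i j).
  exact: radical_system.
have sQ i j : spread (Lam N) 1 (system_mx q N Lam A g M i j).
  exact: spread_system.
have sB i k : spread (Lam N) 0 (input_mx q B i k) by exact: spread_input.
have [X' [U' [h1 h2 h3 h4 h5]]] :=
  control_reduction q0 hLam1 (ltW LamN_gt0) rQ sQ sB T1T XU LX LU.
exists X', U'; split; [exact: h1|exact: h2| |exact: h4|exact: h5].
(* By [dL], T1 - T + d Lam N < T1 - Lam N: the correction has died out before the final window. *)
by move=> i t tt; apply: h3; lra.
Qed.
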